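(* Let $n\ge 1$ be an integer, $0<\alpha\le\frac{n+2}{2}$ and $\lambda>1$. Then the problem $$(\partial_t-\Delta)^\alpha u\ge u^\lambda\ \text{ in }\mathbb{R}^n\times\mathbb{R},\qquad u=0\ \text{ in }\mathbb{R}^n\times(-\infty,0)$$ has a nontrivial nonnegative solution $u\in Y^1_\alpha$ if and only if $$\alpha\ne\frac{n+2}{2}\quad\text{and}\quad\lambda>\lambda_0(n,\alpha):=1+\frac{2\alpha}{n+2-2\alpha}.$$
   Context: For $\alpha>0$ the fractional heat kernel is $$\Phi_\alpha(x,t)=\frac{t^{\alpha-1}}{\Gamma(\alpha)}\frac{1}{(4\pi t)^{n/2}}e^{-|x|^2/(4t)}\ \text{ for } t>0,\qquad \Phi_\alpha(x,t)=0\ \text{ for } t\le 0,\qquad x\in\mathbb{R}^n.$$ $X^1$ is the set of all measurable $f:\mathbb{R}^n\times\mathbb{R}\to\mathbb{R}$ with $\|f\|_{L^1(\mathbb{R}^n\times(-\infty,T))}<\infty$ for all $T\in\mathbb{R}$. Define $$J_\alpha f(x,t)=\iint_{\mathbb{R}^n\times(-\infty,t)}\Phi_\alpha(x-\xi,t-\tau)f(\xi,\tau)\,d\xi\,d\tau,\qquad Y^1_\alpha:=J_\alpha(X^1).$$ When $0<\alpha\le\frac{n+2}{2}$, it is known that $J_\alpha f\in L^1_{\rm loc}(\mathbb{R}^n\times\mathbb{R})$ for $f\in X^1$, that $J_\alpha:X^1\to Y^1_\alpha$ is one-to-one and onto, and that if $f\in X^1$ and $u=J_\alpha f$ then $f=0$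 in $\mathbb{R}^n\times(-\infty,0)$ if and only if $u=0$ in $\mathbb{R}^n\times(-\infty,0)$. The operator $(\partial_t-\Delta)^\alpha:Y^1_\alpha\to X^1$ is defined as the inverse of $J_\alpha:X^1\to Y^1_\alpha$. Functions equal almost everywhere are identified, (in)equalities are understood almost everywhere, and ''nontrivial'' means not a.e. equal to $0$. *)

(* Defs.v *)
From HB Require Import structures.
From mathcomp Require Import all_boot all_order all_algebra.
From mathcomp Require Import all_classical all_reals all_analysis.

Set Implicit Arguments.
Unset Strict Implicit.
Unset Printing Implicit Defensive.

Import Order.TTheory GRing.Theory Num.Theory.
Import numFieldNormedType.Exports.

Local Open Scope classical_set_scope.
Local Open Scope ring_scope.

Definition tuple_cons {R : realType} (n : nat) (p : R * n.-tuple R) :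
  n.+1.-tuple R := [the n.+1.-tuple R of p.1 :: p.2].

Definition tuple_uncons {R : realType} (n : nat) (x : n.+1.-tuple R) :
  R * n.-tuple R := (thead x, [tuple of behead x]).

Lemma tuple_consK {R : realType} (n : nat) :
  cancel (@tuple_cons R n) (@tuple_uncons R n).
Proof.
by move=> [a x]; rewrite /tuple_uncons/= theadE; congr pair; exact/val_inj.
Qed.

Lemma measurable_tuple_cons {R : realType} (n : nat) :
  measurable_fun setT (@tuple_cons R n).
Proof. exact: measurable_cons. Qed.

Lemma measurable_tuple_uncons {R : realType} (n : nat) :
  measurable_fun setT (@tuple_uncons R n).
Proof.
apply/measurable_fun_pair; first exact: measurable_tnth.
exact: measurable_behead.
Qed.

Section lebesgue_step.
Context {R : realType} (n : nat).
Variable m : {sigma_finite_measure set (n.-tuple R) -> \bar R}.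

Definition lebesgue_step : set (n.+1.-tuple R) -> \bar R :=
  pushforward (lebesgue_measure \x m)%E (@tuple_cons R n).

Let measurable_preimage_cons (A : set (n.+1.-tuple R)) :
  measurable A -> measurable (@tuple_cons R n @^-1` A).
Proof. by move=> mA; rewrite -[X in measurable X]setTI; exact: measurable_tuple_cons. Qed.

Let lebesgue_step0 : lebesgue_step set0 = 0%E.
Proof. by rewrite /lebesgue_step /pushforward preimage_set0 measure0. Qed.

Let lebesgue_step_ge0 A : (0 <= lebesgue_step A)%E.
Proof. by rewrite /lebesgue_step /pushforward; exact: measure_ge0. Qed.

Let lebesgue_step_sigma_additive : semi_sigma_additive lebesgue_step.
Proof.
move=> F mF tF mUF; rewrite /lebesgue_step /pushforward preimage_bigcup.
apply: measure_semi_sigma_additive.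
- by move=> k; exact: measurable_preimage_cons.
- apply/trivIsetP => /= i j _ _ ij; rewrite -preimage_setI.
  by move/trivIsetP : tF => /(_ _ _ _ _ ij) ->//; rewrite preimage_set0.
- by rewrite -preimage_bigcup; exact: measurable_preimage_cons.
Qed.

HB.instance Definition _ := isMeasure.Build _ _ _ lebesgue_step
  lebesgue_step0 lebesgue_step_ge0 lebesgue_step_sigma_additive.

Let lebesgue_step_sigma_finite : sigma_finite setT lebesgue_step.
Proof.
have /sigma_finiteP[F [FT ndF mF]] := sigma_finiteT (@lebesgue_measure R).
have /sigma_finiteP[G [GT ndG mG]] := sigma_finiteT m.
exists (fun i => @tuple_uncons R n @^-1` (F i `*` G i)).
  apply/esym; rewrite -subTset => x _.
  have : [set: R] (tuple_uncons x).1 by [].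
  rewrite FT => -[i _ Fi].
  have : [set: n.-tuple R] (tuple_uncons x).2 by [].
  rewrite GT => -[j _ Gj].
  exists (maxn i j) => //; split.
    by have /subsetPset := ndF _ _ (leq_maxl i j); exact.
  by have /subsetPset := ndG _ _ (leq_maxr i j); exact.
move=> i; have [mFi Fioo] := mF i; have [mGi Gioo] := mG i; split.
  rewrite -[X in measurable X]setTI.
  by apply: measurable_tuple_uncons => //; exact: measurableX.
rewrite /lebesgue_step /pushforward -comp_preimage.
rewrite (_ : _ \o _ = id); last by apply/funext => x /=; rewrite tuple_consK.
rewrite preimage_id product_measure1E//.
by rewrite lte_mul_pinfty ?measure_ge0// ge0_fin_numE ?measure_ge0.
Qed.

HB.instance Definition _ := @Measure_isSigmaFinite.Build _ _ _
  lebesgue_step lebesgue_step_sigma_finite.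

End lebesgue_step.

(* n-dimensional Lebesgue measure on the Borel sets of R^n, built as
   an iterated product; R^0 carries the unit mass at its only point. *)
Fixpoint lebesgue_tuple {R : realType} (n : nat) :
    {sigma_finite_measure set (n.-tuple R) -> \bar R} :=
  match n with
  | 0 => [the {sigma_finite_measure set (0.-tuple R) -> \bar R} of
            dirac ([tuple] : 0.-tuple R)]
  | n'.+1 => [the {sigma_finite_measure set (n'.+1.-tuple R) -> \bar R} of
                lebesgue_step (@lebesgue_tuple R n')]
  end.

Definition lebesgue_spacetime {R : realType} (n : nat) :=
  (@lebesgue_tuple R n \x @lebesgue_measure R)%E.
Arguments lebesgue_spacetime {R} n _.

HB.instance Definition _ {R : realType} (n : nat) :=
  Measure.on (@lebesgue_spacetime R n).

Definition tuple_sub {R : realType} (n : nat) (x y : n.-tuple R) : n.-tuple R :=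
  [tuple tnth x i - tnth y i | i < n].

Definition sqr_norm {R : realType} (n : nat) (x : n.-tuple R) : R :=
  \sum_(i < n) tnth x i ^+ 2.

Definition Gamma {R : realType} (a : R) : R :=
  \int[lebesgue_measure]_(s in `]0, +oo[) (s `^ (a - 1) * expR (- s)).

Definition heat_kernel {R : realType} (n : nat) (alpha : R) (x : n.-tuple R)
    (t : R) : R :=
  if 0 < t then
    t `^ (alpha - 1) / Gamma alpha * ((4 * pi * t) `^ (n%:R / 2))^-1
    * expR (- (sqr_norm x / (4 * t)))
  else 0.

Definition past {R : realType} (n : nat) (t : R) : set (n.-tuple R * R) :=
  [set z : n.-tuple R * R | z.2 < t].
Arguments past {R} n t _.

Definition X1 {R : realType} (n : nat) : set (n.-tuple R * R -> R) :=
  [set f : n.-tuple R * R -> R | measurable_fun setT f /\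
    forall T : R,
      (\int[lebesgue_spacetime n]_(z in past n T) `|f z|%:E < +oo)%E].
Arguments X1 {R} n _.

(* Extended-real valued; when neither the positive nor the negative part is
   integrable, the library's integral is -oo, so J takes a finite value at z
   exactly when the integral at z converges absolutely. *)
Definition J {R : realType} (n : nat) (alpha : R) (f : n.-tuple R * R -> R)
    (z : n.-tuple R * R) : \bar R :=
  \int[lebesgue_spacetime n]_(w in past n z.2)
     (heat_kernel alpha (tuple_sub z.1 w.1) (z.2 - w.2) * f w)%:E.

Definition is_J {R : realType} (n : nat) (alpha : R)
    (f u : n.-tuple R * R -> R) : Prop :=
  {ae lebesgue_spacetime n, forall z, (u z)%:E = J alpha f z}.

Definition Y1 {R : realType} (n : nat) (alpha : R) :
    set (n.-tuple R * R -> R) :=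
  [set u : n.-tuple R * R -> R | exists2 f, X1 n f & is_J alpha f u].
Arguments Y1 {R} n alpha _.

(* (d/dt - Laplacian)^alpha, the inverse of J : X^1 -> Y^1: a representative of
   the a.e.-class J^-1 u for u in Y^1, and the junk value 0 for other u *)
Definition frac_heat {R : realType} (n : nat) (alpha : R)
    (u : n.-tuple R * R -> R) : n.-tuple R * R -> R :=
  xget (fun=> 0) [set f | X1 n f /\ is_J alpha f u].

(* Main.v *)
(** Everything rests on two facts about the kernel: the Gaussians form a
    convolution semigroup, and Riemann-Liouville integrals of powers are powers
    (the beta integral).  Hence J maps t^(-b) G_t to a constant times
    t^(alpha-b) G_t, and its adjoint maps (T-t)_+^p G_(S-t) to a constant times
    (T-t)_+^(alpha+p) G_(S-t), whenever T <= S.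

    Existence: f = eps t^(-b) G_t with b = alpha lambda/(lambda-1) - n/2.  The
    two powers of t in (J f)^lambda <= f agree, G_t <= (4 pi t)^(-n/2) takes
    care of space, and f is integrable up to any time exactly when b < 1, that
    is when lambda > lambda_0.

    Nonexistence: test u = J f against (T-t)_+^p G_(2T-t) with
    p = alpha/(lambda-1).  For q = (T-t)^p u the inequality reads
    q^lambda <= (T-t)^(alpha+p) f, so the elementary bound
    q <= M^(1-lambda) q^lambda + M gives
    c int f psi <= M^(1-lambda) int f psi + M T with psi ~ T^(b) on the
    parabolic cylinder of size T.  If b >= 1 the total mass of f is finite, and
    using small M for late times and T -> oo forces it to vanish.

    Injectivity of J (needed to identify the operator on the explicit
    solution): if J f1 = J f2, the adjoint identity equates the moments of
    f1 G_(S-t) and f2 G_(S-t) against (T-t)_+^r for one suitable r <= n/2.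
    Convexity of powers lowers r by one, a further fractional integration of
    increments removes its fractional part, and the resulting equality of
    integrals over {t < T} is a mollification of f1 and f2 by a space-time
    approximate identity. *)
From HB Require Import structures.
Require Import Defs.
From mathcomp Require Import all_boot all_order all_algebra.
From mathcomp Require Import all_classical all_reals all_analysis measurable_realfun.
From mathcomp Require Import ring lra.

Import Order.TTheory GRing.Theory Num.Theory.
Import numFieldNormedType.Exports.

Local Open Scope classical_set_scope.
Local Open Scope ring_scope.

(** The Gaussian factor of the test functions solves the backward heat equation, so the adjoint of
    [J] changes their time factor only: there is no cut-off in space, and what remains to compute is
    a beta integral. With S = 2T the width of the Gaussian stays comparable to sqrt T on 0 <= t < T;
    this produces the power T^b, and b >= 1 holds exactly outside the range of the theorem.
    Integrals are extended-real with nonnegative integrands, so Tonelli suffices; signs are handled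
    by moving negative parts across an identity. Nonexistence works with whichever preimage
    [frac_heat] selects. Existence needs the preimage to be unique in X^1, where a competitor may
    change sign and may live in the whole past. Its integrability over {t < T} controls the moment
    against (T-t)_+^r G_(S-t) as t -> -oo when r <= n/2, while the adjoint produces r > alpha - 1:
    the strict inequality alpha < n/2 + 1 leaves room between the two. Moments of order one may then
    be infinite, which is why the last descent to r = 0 uses increments in T instead of moments. *)

(** * Lebesgue measure: affine substitution and iterated integration *)

Section lebesgue_affine.
Context {R : realType}.
Local Notation mu := (@lebesgue_measure R).

Lemma measurable_affine (a c : R) :
  measurable_fun [set: R] (fun r : R => a + c * r).
Proof. by apply: measurable_funD => //; apply: measurable_funM. Qed.

(** The image of Lebesgue measure under r |-> a + c r, multiplied by c, gives each half-open
    interval its length, so uniqueness identifies it with Lebesgue measure. *)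
Lemma ge0_integral_affine (a c : R) (f : R -> \bar R) : 0 < c ->
  measurable_fun setT f -> (forall r, 0 <= f r)%E ->
  (\int[mu]_r f r = c%:E * \int[mu]_r f (a + c * r)%R)%E.
Proof.
move=> c0 mf f0.
pose phi : measurableTypeR R -> measurableTypeR R := fun r => a + c * r.
have mphi : measurable_fun setT phi by exact: measurable_affine.
pose m0 := mscale (NngNum (ltW c0)) (pushforward mu phi).
pose m' := m0 mphi.
have m'E A : measurable A -> mu A = m' A.
  apply: lebesgue_measure_unique => _ [[x y]] _ <-.
  transitivity (c%:E * mu (phi @^-1` `]x, y]%classic))%E; last by [].
  have -> : phi @^-1` `]x, y]%classic = `](x - a) / c, (y - a) / c]%classic.
    apply/seteqP; split=> r /=; rewrite !in_itv/= /phi;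
    by rewrite ltr_pdivrMr// ler_pdivlMr// ltrBlDl lerBrDl [r * c]mulrC.
  rewrite !lebesgue_measure_itv/= !lte_fin ltr_pM2r ?invr_gt0// ltrD2r.
  case: ifPn => _; last by rewrite mule0.
  by rewrite -!EFinD -EFinM; congr EFin; field; rewrite gt_eqF.
rewrite (eq_measure_integral m'); last by move=> A mA _; exact: m'E.
rewrite ge0_integral_mscale//=; congr (_ * _)%E.
by rewrite ge0_integral_pushforward.
Qed.

End lebesgue_affine.

Section lebesgue_tuple_theory.
Context {R : realType}.
Local Notation mu := (@lebesgue_measure R).

Lemma ge0_integral_lebesgue_tuple0 (f : 0.-tuple R -> \bar R) :
  measurable_fun setT f ->
  (\int[@lebesgue_tuple R 0]_x f x = f [tuple])%E.
Proof. by move=> mf; rewrite integral_dirac// diracT mul1e. Qed.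

Lemma ge0_integral_lebesgue_tupleS n (f : n.+1.-tuple R -> \bar R) :
  measurable_fun setT f -> (forall x, 0 <= f x)%E ->
  (\int[@lebesgue_tuple R n.+1]_x f x =
   \int[mu]_a \int[@lebesgue_tuple R n]_x f (tuple_cons (a, x)))%E.
Proof.
move=> mf f0.
rewrite [LHS](_ : _ =
   \int[pushforward (mu \x @lebesgue_tuple R n)%E (@tuple_cons R n)]_x f x)%E//.
rewrite ge0_integral_pushforward//; last exact: measurable_tuple_cons.
rewrite preimage_setT fubini_tonelli1//.
- by apply: measurableT_comp => //; exact: measurable_tuple_cons.
- by move=> z /=.
Qed.

End lebesgue_tuple_theory.

(** Writing 1/r as r times the power -1 of r^2 reduces the claim to measurability of [powR]. The
    square makes the base nonnegative, and the formula respects 0^-1 = 0. *)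
Lemma measurable_funV {R : realType} d (T : measurableType d) (f : T -> R) :
  measurable_fun setT f -> measurable_fun setT (fun x => (f x)^-1).
Proof.
move=> mf; rewrite (_ : (fun x => _) = (fun x => f x * (f x ^+ 2) `^ (-1))).
  apply: measurable_funM => //; apply: (measurableT_comp (f := @powR R ^~ _)) => //.
  exact: measurable_funX.
apply/funext => x; rewrite powR_inv1 ?sqr_ge0// expr2.
by have [->|fx0] := eqVneq (f x) 0; [rewrite invr0 mul0r|rewrite invfM mulrA divff ?mul1r].
Qed.

(** * Gaussians and their convolution semigroup *)

Section gauss1.
Context {R : realType}.
Local Notation mu := (@lebesgue_measure R).

Definition gauss1 (s r : R) : R :=
  ((4 * pi * s) `^ 2^-1)^-1 * expR (- (r ^+ 2 / (4 * s))).

Lemma gauss1_ge0 s r : 0 <= gauss1 s r.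
Proof. by rewrite mulr_ge0// ?expR_ge0// invr_ge0 powR_ge0. Qed.

Lemma gauss1N s r : gauss1 s (- r) = gauss1 s r.
Proof. by rewrite /gauss1 sqrrN. Qed.

Lemma measurable_gauss1 d (T : measurableType d) (f g : T -> R) :
  measurable_fun setT f -> measurable_fun setT g ->
  measurable_fun setT (fun x => gauss1 (f x) (g x)).
Proof.
move=> mf mg; apply: measurable_funM.
  apply: measurable_funV.
  apply: (measurableT_comp (f := @powR R ^~ _)) => //.
  exact: measurable_funM.
apply: measurableT_comp => //; apply: measurableT_comp => //.
apply: measurable_funM; first exact: measurable_funX.
apply: measurable_funV.
exact: measurable_funM.
Qed.

Lemma gauss1_normal_pdf s m r : 0 < s ->
  gauss1 s (r - m) = normal_pdf m (Num.sqrt (2 * s)) r.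
Proof.
move=> s0; have s20 : 0 < 2 * s by rewrite mulr_gt0.
rewrite /gauss1 powR12_sqrt ?mulr_ge0 ?pi_ge0 ?ltW// normal_pdfE ?gt_eqF ?sqrtr_gt0// /normal_peak /normal_fun.
rewrite !sqr_sqrtr ?ltW// mulNr; congr ((Num.sqrt _)^-1 * expR (- (_ / _)));
  by rewrite -mulr_natr; ring.
Qed.

Lemma integral_gauss1 s m : 0 < s -> (\int[mu]_r (gauss1 s (r - m))%:E = 1)%E.
Proof.
move=> s0; under eq_integral do rewrite gauss1_normal_pdf//.
exact: integral_normal_pdf.
Qed.

(** Completing the square in [r]: the two centres merge into their weighted mean, and what is left
    over depends on [a - b] alone. *)
Lemma gauss1M s t a b r : 0 < s -> 0 < t ->
  gauss1 s (r - a) * gauss1 t (r - b) =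
  gauss1 (s + t) (a - b) *
    gauss1 (s * t / (s + t)) (r - (t * a + s * b) / (s + t)).
Proof.
move=> s0 t0; have st0 : 0 < s + t by rewrite addr_gt0.
rewrite /gauss1 mulrACA -expRD [RHS]mulrACA -expRD.
congr (_ * expR _).
- rewrite -!invfM; congr (_^-1).
  have ? : 0 < (s + t)^-1 by rewrite invr_gt0.
  rewrite -!powRM ?mulr_ge0 ?pi_ge0 ?ltW//; congr (_ `^ _).
  by field; rewrite gt_eqF.
- by field; rewrite !gt_eqF.
Qed.

Lemma integral_gauss1M s t a b : 0 < s -> 0 < t ->
  (\int[mu]_r (gauss1 s (r - a) * gauss1 t (r - b))%:E =
    (gauss1 (s + t) (a - b))%:E)%E.
Proof.
move=> s0 t0; under eq_integral do rewrite gauss1M// EFinM.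
rewrite ge0_integralZl//.
- rewrite integral_gauss1 ?mule1//.
  by rewrite divr_gt0 ?mulr_gt0 ?addr_gt0.
- apply/measurable_EFinP; apply: measurable_gauss1 => //.
  exact: measurable_funB.
- by move=> *; rewrite lee_fin gauss1_ge0.
- by rewrite lee_fin gauss1_ge0.
Qed.

End gauss1.

Section gauss.
Context {R : realType}.
Local Notation mu := (@lebesgue_measure R).

(** The Gaussian factor of [heat_kernel]. Its value at [s <= 0] carries no meaning; the integrals
    below pair it with a time factor that vanishes there. *)
Definition gauss (n : nat) (s : R) (x : n.-tuple R) : R :=
  ((4 * pi * s) `^ (n%:R / 2))^-1 * expR (- (sqr_norm x / (4 * s))).

Arguments gauss {n} s x.

Lemma gauss_ge0 n s (x : n.-tuple R) : 0 <= gauss s x.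
Proof. by rewrite mulr_ge0// ?expR_ge0// invr_ge0 powR_ge0. Qed.

Lemma gauss_gt0 n s (x : n.-tuple R) : 0 < s -> 0 < gauss s x.
Proof.
move=> s0; rewrite mulr_gt0 ?expR_gt0// invr_gt0 powR_gt0//.
by rewrite !mulr_gt0// pi_gt0.
Qed.

Lemma sqr_norm_ge0 n (x : n.-tuple R) : 0 <= sqr_norm x.
Proof. by apply: sumr_ge0 => i _; exact: sqr_ge0. Qed.

Lemma sqr_normC n (x y : n.-tuple R) :
  sqr_norm (tuple_sub x y) = sqr_norm (tuple_sub y x).
Proof. by apply: eq_bigr => i _; rewrite !tnth_mktuple -sqrrN opprB. Qed.

Lemma gaussC n s (x y : n.-tuple R) :
  gauss s (tuple_sub x y) = gauss s (tuple_sub y x).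
Proof. by rewrite /gauss sqr_normC. Qed.

Lemma gauss_le_peak n s (x : n.-tuple R) : 0 < s ->
  gauss s x <= ((4 * pi * s) `^ (n%:R / 2))^-1.
Proof.
move=> s0; rewrite ler_piMr// ?invr_ge0 ?powR_ge0//.
rewrite -[leRHS]expR0 ler_expR oppr_le0 divr_ge0 ?sqr_norm_ge0//.
by rewrite mulr_ge0 ?ltW.
Qed.

Lemma sqr_norm_cons n (p : R * n.-tuple R) (y : n.+1.-tuple R) :
  sqr_norm (tuple_sub (tuple_cons p) y) =
  (p.1 - thead y) ^+ 2 + sqr_norm (tuple_sub p.2 [tuple of behead y]).
Proof.
rewrite /sqr_norm big_ord_recl; congr (_ + _).
  by rewrite tnth_mktuple /tuple_cons tnth0.
apply: eq_bigr => i _; rewrite !tnth_mktuple /tuple_cons tnthS.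
congr ((_ - _) ^+ 2); rewrite [in RHS](tnth_nth 0) [LHS](tnth_nth 0)/= nth_behead.
by [].
Qed.

Lemma gaussS n s (p : R * n.-tuple R) (y : n.+1.-tuple R) : 0 < s ->
  gauss s (tuple_sub (tuple_cons p) y) =
  gauss1 s (p.1 - thead y) * gauss s (tuple_sub p.2 [tuple of behead y]).
Proof.
move=> s0; have c0 : 0 < 4 * pi * s by rewrite !mulr_gt0// pi_gt0.
rewrite /gauss /gauss1 sqr_norm_cons [in LHS](mulrDl (_ ^+ 2)) opprD expRD.
rewrite -[n.+1%:R]natr1 (mulrDl n%:R) powRD ?gt_eqF ?implybT// mul1r invfM.
by rewrite [RHS]mulrACA; congr (_ * _); rewrite mulrC.
Qed.

Lemma measurable_tuple_sub d (T : measurableType d) n (f g : T -> n.-tuple R) :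
  measurable_fun setT f -> measurable_fun setT g ->
  measurable_fun setT (fun x => tuple_sub (f x) (g x)).
Proof.
move=> /measurable_fun_tnthP mf /measurable_fun_tnthP mg.
apply/measurable_fun_tnthP => i.
rewrite (_ : _ \o _ = fun x => tnth (f x) i - tnth (g x) i).
  by apply: measurable_funB; [exact: mf|exact: mg].
by apply/funext => x /=; rewrite tnth_mktuple.
Qed.

Lemma measurable_sqr_norm d (T : measurableType d) n (f : T -> n.-tuple R) :
  measurable_fun setT f -> measurable_fun setT (fun x => sqr_norm (f x)).
Proof.
move=> /measurable_fun_tnthP mf; apply: measurable_sum => i.
by apply: measurable_funX; exact: mf.
Qed.

Lemma measurable_gauss d (T : measurableType d) n (f : T -> R)
    (g : T -> n.-tuple R) :
  measurable_fun setT f -> measurable_fun setT g ->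
  measurable_fun setT (fun x => gauss (f x) (g x)).
Proof.
move=> mf mg; apply: measurable_funM.
  apply: measurable_funV.
  apply: (measurableT_comp (f := @powR R ^~ _)) => //.
  exact: measurable_funM.
apply: measurableT_comp => //; apply: measurableT_comp => //.
apply: measurable_funM; first exact: measurable_sqr_norm.
apply: measurable_funV.
exact: measurable_funM.
Qed.

(** Chapman-Kolmogorov, by induction on the dimension: [gaussS] splits off one coordinate, where the
    one-dimensional identity applies. *)
Lemma integral_gaussM n s t (y z : n.-tuple R) : 0 < s -> 0 < t ->
  (\int[lebesgue_tuple n]_x
     (gauss s (tuple_sub x y) * gauss t (tuple_sub x z))%:E =
   (gauss (s + t) (tuple_sub y z))%:E)%E.
Proof.
move=> s0 t0.
have mg m (u v : m.-tuple R) : measurable_fun setT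
    (fun x => (gauss s (tuple_sub x u) * gauss t (tuple_sub x v))%:E).
  by apply/measurable_EFinP; apply: measurable_funM; apply: measurable_gauss => //;
    apply: measurable_tuple_sub.
elim: n y z => [|n IH] y z.
  rewrite ge0_integral_lebesgue_tuple0//.
  by rewrite /gauss /sqr_norm !big_ord0 !mul0r !oppr0 expR0 !powRr0 invr1 !mulr1.
rewrite ge0_integral_lebesgue_tupleS//; last first.
  by move=> x; rewrite lee_fin mulr_ge0 ?gauss_ge0.
under eq_integral => a _.
  under eq_integral => x _.
    rewrite !gaussS//= mulrACA EFinM.
    over.
  rewrite ge0_integralZl//; last 3 first.
  - exact: mg.
  - by move=> x _; rewrite lee_fin mulr_ge0 ?gauss_ge0.
  - by rewrite lee_fin mulr_ge0 ?gauss1_ge0.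
  rewrite IH.
  over.
rewrite /= ge0_integralZr//; last 3 first.
- by apply/measurable_EFinP; apply: measurable_funM; apply: measurable_gauss1 => //;
    apply: measurable_funB.
- by move=> x _; rewrite lee_fin mulr_ge0 ?gauss1_ge0.
- by rewrite lee_fin gauss_ge0.
rewrite integral_gauss1M// -EFinM; congr EFin.
have yE : y = tuple_cons (thead y, [tuple of behead y]).
  by case/tupleP : y => b y; apply/val_inj.
by rewrite [in RHS]yE gaussS ?addr_gt0.
Qed.

Lemma integral_gauss n s (y : n.-tuple R) : 0 < s ->
  (\int[lebesgue_tuple n]_x (gauss s (tuple_sub x y))%:E = 1)%E.
Proof.
move=> s0.
have mg m (u : m.-tuple R) : measurable_fun setT
    (fun x => (gauss s (tuple_sub x u))%:E).
  by apply/measurable_EFinP; apply: measurable_gauss => //;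
    apply: measurable_tuple_sub.
elim: n y => [|n IH] y.
  rewrite ge0_integral_lebesgue_tuple0//.
  by rewrite /gauss /sqr_norm !big_ord0 !mul0r !oppr0 expR0 !powRr0 invr1 !mulr1.
rewrite ge0_integral_lebesgue_tupleS//; last first.
  by move=> x; rewrite lee_fin gauss_ge0.
rewrite -((integral_gauss1 _ (thead y) s0)); apply: eq_integral => a _.
under eq_integral do rewrite gaussS// EFinM /=.
rewrite ge0_integralZl//; last 3 first.
- exact: mg.
- by move=> x _; rewrite lee_fin gauss_ge0.
- by rewrite lee_fin gauss1_ge0.
by rewrite IH mule1.
Qed.

End gauss.
Arguments gauss {R n} s x.

(** * Truncated powers, the beta integral and positivity of Gamma *)

Section positive_power.
Context {R : realType}.
Local Notation mu := (@lebesgue_measure R).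

(* The power s_+^b, with the indicator of s > 0 as its zeroth power. *)
Definition pw (b s : R) : R := if 0 < s then s `^ b else 0.

Lemma pw_ge0 b s : 0 <= pw b s.
Proof. by rewrite /pw; case: ifPn => // _; exact: powR_ge0. Qed.

Lemma pw_gt0 b s : 0 < s -> 0 < pw b s.
Proof. by move=> s0; rewrite /pw s0 powR_gt0. Qed.

Lemma pw_pos b s : 0 < s -> pw b s = s `^ b.
Proof. by move=> s0; rewrite /pw s0. Qed.

Lemma pw_neg b s : s <= 0 -> pw b s = 0.
Proof. by move=> s0; rewrite /pw ltNge s0. Qed.

Lemma pwM a b s : pw a s * pw b s = pw (a + b) s.
Proof.
rewrite /pw; case: ifPn => [s0|_]; last by rewrite mul0r.
by rewrite -powRD// (gt_eqF s0) implybT.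
Qed.

Lemma pwZ b c s : 0 < c -> pw b (c * s) = c `^ b * pw b s.
Proof.
move=> c0; rewrite /pw pmulr_rgt0//; case: ifPn => [s0|_]; last by rewrite mulr0.
by rewrite powRM// ltW.
Qed.

Lemma pw1 s : pw 1 s = Num.max s 0.
Proof.
rewrite /pw; case: ifPn => [s0|]; first by rewrite powRr1 ?ltW// max_l ?ltW.
by rewrite -leNgt => s0; rewrite max_r.
Qed.

Lemma ler_pw b s t : 0 <= b -> s <= t -> pw b s <= pw b t.
Proof.
move=> b0 st; rewrite /pw; case: ifPn => [s0|_]; last first.
  by case: ifPn => // _; exact: powR_ge0.
by rewrite (lt_le_trans s0 st) ge0_ler_powR// nnegrE ltW// (lt_le_trans s0 st).
Qed.

Lemma measurable_pw d (T : measurableType d) b (f : T -> R) :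
  measurable_fun setT f -> measurable_fun setT (fun x => pw b (f x)).
Proof.
move=> mf; apply: (measurableT_comp (f := pw b)) => //.
rewrite (_ : pw b = fun s => s `^ b * \1_(`]0, +oo[%classic) s).
  by apply: measurable_funM => //; exact: measurable_indic.
apply/funext => s; rewrite /pw indicE; case: ifPn => s0.
  by rewrite mem_set ?mulr1//= in_itv/= s0.
by rewrite memNset ?mulr0//= in_itv/= andbT; exact/negP.
Qed.

(** For q < 0 the integrand blows up at 0, so the fundamental theorem of calculus is applied on
    compact intervals away from 0, followed by monotone convergence. *)
Lemma integral_powR01_le (q : R) : -1 < q ->
  (\int[mu]_(x in `]0%R, 1%R]) (x `^ q)%:E <= (q + 1)^-1%:E)%E.
Proof.
move=> q1; have q10 : 0 < q + 1 by rewrite -ltrBlDr sub0r.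
(* Starting at 1/(k+2) keeps every interval nondegenerate, also for k = 0. *)
pose F (k : nat) : set R := `[k.+2%:R^-1, 1]%classic.
have F01 : \bigcup_k F k = `]0, 1]%classic.
  apply/seteqP; split=> [x [k _]|x]; rewrite /F/= !in_itv/=.
    by move=> /andP[kx ->]; rewrite (lt_le_trans _ kx).
  move=> /andP[x0 x1].
  have [k _ /(_ k (leqnn _))/= kx] := near_infty_natSinv_lt (PosNum x0).
  exists k => //=; rewrite in_itv/= x1 andbT.
  by rewrite (le_trans _ (ltW kx))// lef_pV2 ?posrE// ler_nat.
have Fpos k x : F k x -> 0 < x.
  by rewrite /F/= in_itv/= => /andP[+ _]; apply: lt_le_trans.
have cpow r x : 0 < x -> {for x, continuous (@powR R ^~ r)}.
  move=> x0; apply: differentiable_continuous; apply/derivable1_diffP.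
  by apply: derivable_powR; rewrite in_itv/= x0.
rewrite -F01.
have : (\int[mu]_(x in F k) (x `^ q)%:E @[k --> \oo] -->
    \int[mu]_(x in \bigcup_k F k) (x `^ q)%:E)%E.
  apply: ge0_nondecreasing_set_cvg_integral.
  - move=> m n mn; rewrite subsetEset; apply: subset_itvr.
    by rewrite bnd_simp lef_pV2 ?posrE// ler_nat.
  - by move=> i; exact: measurable_itv.
  - by move=> i; apply/measurable_EFinP; exact: measurable_funTS.
  - by move=> i x _; rewrite lee_fin powR_ge0.
move=> /cvg_lim <-//; apply: lime_le.
  apply: ereal_nondecreasing_is_cvgn => m n mn.
  apply: ge0_subset_integral => //=; try exact: measurable_itv.
  - by apply/measurable_EFinP; exact: measurable_funTS.
  - by move=> *; rewrite lee_fin powR_ge0.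
  - by apply: subset_itvr; rewrite bnd_simp lef_pV2 ?posrE// ler_nat.
apply: nearW => k.
rewrite (@continuous_FTC2 _ _ (fun x => x `^ (q + 1) / (q + 1))).
- by rewrite -EFinD lee_fin powR1 mul1r gerBl divr_ge0 ?powR_ge0 ?ltW.
- by rewrite invf_lt1// ltr1n.
- apply: continuous_in_subspaceT => x; rewrite inE => /Fpos x0.
  exact: cpow.
- have k0 : 0 < k.+2%:R^-1 :> R by [].
  split.
  + move=> x; rewrite in_itv/= => /andP[kx _].
    by apply: derivableM => //; apply: derivable_powR; rewrite in_itv/= (lt_trans k0 kx).
  + apply: cvg_at_right_filter; apply: cvgM; last exact: cvg_cst.
    exact: cpow.
  + apply: cvg_at_left_filter; apply: cvgM; last exact: cvg_cst.
    exact: cpow.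
- move=> x; rewrite in_itv/= => /andP[kx _].
  have x0 : 0 < x by rewrite (lt_trans _ kx).
  rewrite derive1E deriveM//; last by apply: derivable_powR; rewrite in_itv/= x0.
  rewrite derive_cst scaler0 add0r.
  have [_ ->] := @is_derive1_powR _ (q + 1) x x0.
  by rewrite addrK /GRing.scale/= mulrA mulVf ?gt_eqF// mul1r.
Qed.

End positive_power.

Lemma ge0_integral_gt0 d (T : measurableType d) (R : realType)
    (m : {measure set T -> \bar R}) (A : set T) (f : T -> \bar R) :
  measurable A -> m A != 0%E -> measurable_fun setT f ->
  (forall x, 0 <= f x)%E -> (forall x, A x -> 0 < f x)%E ->
  (0 < \int[m]_x f x)%E.
Proof.
move=> mA A0 mf f0 fA; rewrite lt0e integral_ge0// andbT.
apply/eqP => If0; move/eqP: A0; apply.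
have : (\int[m]_x `|f x| = 0)%E.
  by rewrite -If0; apply: eq_integral => x _; rewrite gee0_abs.
move/(ae_eq_integral_abs _ measurableT mf) => [N [mN N0 AN]].
apply: subset_measure0 mN _ N0 => // x Ax; apply: AN => /= /(_ I)/= fx.
by have := fA _ Ax; rewrite fx ltxx.
Qed.

Section beta.
Context {R : realType}.
Local Notation mu := (@lebesgue_measure R).

Let lebesgue_measure01_neq0 :
  lebesgue_measure (`]0%R, 1%R[%classic : set R) != 0%E.
Proof. by rewrite lebesgue_measure_itv/= lte_fin ltr01 oppr0 adde0 gt_eqF. Qed.

(** The slope -1 is outside the scope of [ge0_integral_affine], so a translation is combined with
    the invariance of Lebesgue measure under negation. *)
Lemma ge0_integral_onem (f : R -> \bar R) :
  measurable_fun setT f -> (forall r, 0 <= f r)%E ->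
  (\int[mu]_r f r = \int[mu]_r f (1 - r)%R)%E.
Proof.
move=> mf f0; transitivity (\int[mu]_r f (1 + 1 * r)%R)%E.
  by rewrite [LHS](@ge0_integral_affine _ 1 1)// mul1e.
under eq_integral do rewrite mul1r.
have m1 : measurable_fun [set: R] (fun r => f (1 + r)).
  by apply: measurableT_comp => //; exact: measurable_funD.
have mN : measurable_fun setT (-%R : measurableTypeR R -> measurableTypeR R).
  by exact: oppr_measurable.
transitivity (\int[pushforward mu (-%R : measurableTypeR R -> measurableTypeR R)]_r
   f (1 + r)%R)%E.
  by apply: eq_measure_integral => A mA _; apply/esym; exact: lebesgue_measureN.
by rewrite ge0_integral_pushforward.
Qed.

(** Euler's B(a, p + 1); the two [pw] factors cut the line down to ]0, 1[. With the shifted second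
    argument, convergence reads [0 < a] and [-1 < p]. *)
Definition beta (a p : R) : \bar R :=
  \int[mu]_r (pw (a - 1) r * pw p (1 - r))%:E.

Lemma measurable_beta_integrand (a p t T : R) :
  measurable_fun setT (fun r : R => pw (a - 1) (r - t) * pw p (T - r)).
Proof.
by apply: measurable_funM; apply: measurable_pw; apply: measurable_funB.
Qed.

Lemma beta_gt0 a p : (0 < beta a p)%E.
Proof.
apply: (@ge0_integral_gt0 _ _ _ mu `]0%R, 1%R[%classic).
- exact: measurable_itv.
- exact: lebesgue_measure01_neq0.
- apply/measurable_EFinP; have := measurable_beta_integrand a p 0 1.
  by apply: eq_measurable_fun => r _; rewrite subr0.
- by move=> r; rewrite lee_fin mulr_ge0 ?pw_ge0.
- move=> r /=; rewrite in_itv/= => /andP[r0 r1].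
  by rewrite lte_fin mulr_gt0 ?pw_gt0 ?subr_gt0.
Qed.

Lemma powR_le_half (q r : R) : 2^-1 <= r <= 1 -> r `^ q <= Num.max 1 (2^-1 `^ q).
Proof.
move=> /andP[r2 r1]; have r0 : 0 < r by rewrite (lt_le_trans _ r2).
have [q0|q0] := leP 0 q.
  rewrite le_max; apply/orP; left.
  apply: (@le_trans _ _ (1 `^ q)); last by rewrite powR1.
  by rewrite ge0_ler_powR ?nnegrE// ltW.
rewrite le_max; apply/orP; right.
rewrite -[q]opprK 2!(powRN _ (- q)) lef_pV2 ?posrE ?powR_gt0//.
by rewrite ge0_ler_powR ?nnegrE ?oppr_ge0// ltW.
Qed.

(** On each half of ]0, 1[ only one factor can be singular; the other is bounded by [C]. The sum [h]
    of the two resulting bounds dominates everywhere. *)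
Lemma beta_lty a p : 0 < a -> -1 < p -> (beta a p < +oo)%E.
Proof.
move=> a0 p1; pose C q : R := Num.max 1 (2^-1 `^ q).
have C0 q : 0 <= C q by rewrite le_max ler01.
pose g (q r : R) : \bar R := ((fun r => (r `^ q)%:E) \_ `]0%R, 1%R]) r.
have mg q : measurable_fun setT (g q).
  apply/(measurable_restrictT _ (measurable_itv _)).
  by apply/measurable_EFinP; exact: measurable_funTS.
have g0 q r : (0 <= g q r)%E.
  by apply: erestrict_ge0 => x _; rewrite lee_fin powR_ge0.
have gE q r : 0 < r <= 1 -> g q r = (r `^ q)%:E.
  by move=> r01; rewrite /g patchE mem_set//= in_itv.
have gI q : -1 < q -> (\int[mu]_r g q r < +oo)%E.
  move=> q1; rewrite /g -integral_mkcond.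
  by rewrite (le_lt_trans (integral_powR01_le _ q1))// ltry.
have mg1 q : measurable_fun setT (fun r : R => g q (1 - r)).
  by apply: measurableT_comp => //; exact: measurable_funB.
pose h (r : R) : \bar R := ((C p)%:E * g (a - 1)%R r + (C (a - 1)%R)%:E * g p (1 - r)%R)%E.
have h0 r : (0 <= h r)%E by apply: adde_ge0; apply: mule_ge0 => //; rewrite lee_fin.
apply: (@le_lt_trans _ _ (\int[mu]_r h r)%E); last rewrite /h.
  apply: ge0_le_integral => //.
  - by move=> r _; rewrite lee_fin mulr_ge0 ?pw_ge0.
  - apply/measurable_EFinP; have := measurable_beta_integrand a p 0 1.
    by apply: eq_measurable_fun => r _; rewrite subr0.
  - rewrite /h; apply: emeasurable_funD; apply: measurable_funeM; [exact: mg|exact: mg1].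
  - move=> r _; have [r0|r0] := leP r 0.
      rewrite pw_neg// mul0r adde_ge0// mule_ge0// lee_fin//.
    have [r1|r1] := leP 1 r.
      by rewrite [pw p _]pw_neg ?subr_le0// mulr0; exact: h0.
    rewrite /h !pw_pos ?subr_gt0// !gE; last 2 first.
    + by rewrite subr_gt0 r1 gerBl ltW.
    + by rewrite r0 ltW.
    rewrite -!EFinM -EFinD lee_fin; have [r2|r2] := leP r 2^-1.
      rewrite mulrC (le_trans (y := C p * r `^ (a - 1)))//.
        rewrite ler_wpM2r ?powR_ge0// powR_le_half//.
        by apply/andP; split; lra.
      by rewrite lerDl mulr_ge0 ?powR_ge0.
    rewrite (le_trans (y := C (a - 1) * (1 - r) `^ p))//.
      rewrite ler_wpM2r ?powR_ge0// powR_le_half//.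
      by apply/andP; split; lra.
    by rewrite lerDr mulr_ge0 ?powR_ge0.
rewrite ge0_integralD//; last 4 first.
- by move=> r _; apply: mule_ge0 => //; rewrite lee_fin.
- by apply: measurable_funeM; exact: mg.
- by move=> r _; apply: mule_ge0 => //; rewrite lee_fin.
- by apply: measurable_funeM; exact: mg1.
rewrite !ge0_integralZl//; try exact: mg; try exact: mg1; try by rewrite lee_fin.
rewrite -(ge0_integral_onem (g p))//.
have ap : -1 < a - 1 by lra.
by apply: lte_add_pinfty; apply: lte_mul_pinfty => //; rewrite ?lee_fin//; exact: gI.
Qed.

Definition betaR a p : R := fine (beta a p).

Lemma betaR_gt0 a p : 0 < a -> -1 < p -> 0 < betaR a p.
Proof. by move=> a0 p1; rewrite fine_gt0// beta_gt0 beta_lty. Qed.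

(** The substitution r = t + (T - t) s pulls out T - t to the power 1 + (a - 1) + p. If T <= t, the
    two factors are never positive together and both sides vanish. *)
Lemma integral_beta a p t T : 0 < a -> -1 < p ->
  (\int[mu]_r (pw (a - 1) (r - t) * pw p (T - r))%:E =
   (betaR a p * pw (a + p) (T - t))%:E)%E.
Proof.
move=> a0 p1; have [Tt|tT] := leP T t.
  rewrite [pw (a + p) _]pw_neg ?subr_le0// mulr0.
  apply: integral0_eq => r _; have [rt|rt] := leP r t.
    by rewrite pw_neg ?subr_le0// mul0r.
  by rewrite [pw p _]pw_neg ?mulr0// subr_le0 (le_trans Tt)// ltW.
have c0 : 0 < T - t by rewrite subr_gt0.
rewrite [LHS](@ge0_integral_affine _ t (T - t))//; last 2 first.
- by apply/measurable_EFinP; exact: measurable_beta_integrand.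
- by move=> r; rewrite lee_fin mulr_ge0 ?pw_ge0.
under eq_integral => r _.
  rewrite (_ : t + _ - t = (T - t) * r); last by ring.
  rewrite (_ : T - (t + _) = (T - t) * (1 - r)); last by ring.
  rewrite !pwZ// mulrACA EFinM.
  over.
rewrite ge0_integralZl//; last 3 first.
- apply/measurable_EFinP; have := measurable_beta_integrand a p 0 1.
  by apply: eq_measurable_fun => r _; rewrite subr0.
- by move=> r _; rewrite lee_fin mulr_ge0 ?pw_ge0.
- by rewrite lee_fin mulr_ge0 ?powR_ge0.
rewrite -/(beta a p) -[beta a p]fineK; last first.
  by rewrite ge0_fin_numE ?beta_lty// ltW// beta_gt0.
rewrite -!EFinM; congr EFin; rewrite /betaR mulrA [RHS]mulrC; congr (_ * _).
rewrite pw_pos// -[X in X * _](powRr1 (ltW c0)) -!powRD ?(gt_eqF c0) ?implybT//.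
by congr (_ `^ _); ring.
Qed.

(** [Gamma] is the finite part of an extended integral, which would be 0 if the integral diverged;
    so convergence must be proved along with positivity, by the power near 0 and by an exponential
    density of rate 1/2 beyond 1. *)
Lemma Gamma_gt0 (a : R) : 0 < a -> 0 < Gamma a.
Proof.
move=> a0; rewrite /Gamma /Rintegral.
have mG : measurable_fun [set: R] (fun s : R => s `^ (a - 1) * expR (- s)).
  by apply: measurable_funM => //; apply: measurableT_comp.
have G0 s : 0 <= s `^ (a - 1) * expR (- s) by rewrite mulr_ge0 ?powR_ge0 ?expR_ge0.
rewrite fine_gt0//; apply/andP; split.
  rewrite integral_mkcond.
  apply: (@ge0_integral_gt0 _ _ _ mu `]0%R, 1%R[%classic).
  - exact: measurable_itv.
  - exact: lebesgue_measure01_neq0.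
  - apply/(measurable_restrictT _ (measurable_itv _)).
    by apply/measurable_EFinP; exact: measurable_funTS.
  - by apply: erestrict_ge0 => x _; rewrite lee_fin.
  - move=> s /=; rewrite in_itv/= => /andP[s0 s1].
    by rewrite patchE mem_set/= ?in_itv/= ?s0// lte_fin mulr_gt0 ?powR_gt0 ?expR_gt0.
have -> : `]0%R, +oo[%classic = `]0%R, 1%R] `|` `]1%R, +oo[%classic :> set R.
  by rewrite -itv_bndbnd_setU// bnd_simp.
rewrite ge0_integral_setU//=; last 3 first.
- by apply/measurable_EFinP; exact: measurable_funTS.
- by move=> s _; rewrite lee_fin.
- apply/disj_setPLR => s /=; rewrite !in_itv/= => /andP[_ s1].
  by rewrite andbT => /lt_le_trans/(_ s1); rewrite ltxx.
apply: lte_add_pinfty.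
  apply: (@le_lt_trans _ _ (\int[mu]_(x in `]0%R, 1%R]) (x `^ (a - 1))%:E)%E).
    apply: ge0_le_integral => //.
    - by move=> s _; rewrite lee_fin.
    - by apply/measurable_EFinP; exact: measurable_funTS.
    - by apply/measurable_EFinP; exact: measurable_funTS.
    - move=> s; rewrite /= in_itv/= => /andP[s0 _].
      by rewrite lee_fin ler_piMr ?powR_ge0// -expR0 ler_expR oppr_le0 ltW.
  by rewrite (le_lt_trans (integral_powR01_le _ _)) ?ltry//; lra.
(* One Taylor term of exp(s/2), of order [N.+1] > a - 1, dominates s^(a-1) for s > 1 up to the
   factor [C]. The extra 2 in [C * 2] cancels the rate 1/2 in front of the density. *)
pose N := (Num.trunc a).+1.
pose C : R := 2 ^+ N.+1 * N.+1`!%:R.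
have C0 : 0 <= C by rewrite mulr_ge0 ?exprn_ge0.
have C20 : 0 <= C * 2 by rewrite mulr_ge0.
have mE : measurable_fun [set: R] (exponential_pdf (2^-1 : R)).
  exact: measurable_exponential_pdf.
apply: (@le_lt_trans _ _ (\int[mu]_(x in `]1%R, +oo[)
    ((C * 2)%:E * (exponential_pdf 2^-1 x)%:E))%E).
  apply: ge0_le_integral => //.
  - by move=> s _; rewrite lee_fin.
  - by apply/measurable_EFinP; exact: measurable_funTS.
  - by apply: measurable_funeM; apply/measurable_EFinP; exact: measurable_funTS.
  - move=> s; rewrite /= in_itv/= andbT => s1.
    have s0 : 0 < s by rewrite (lt_trans _ s1).
    rewrite -EFinM lee_fin exponential_pdfE; last exact: ltW.
    rewrite -mulrA [2 * _]mulrA divff// mul1r.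
    rewrite (_ : - s = s / 2 * -1 + - 2^-1 * s); last by field.
     rewrite expRD mulrA ler_wpM2r ?expR_ge0// mulrN1.
    rewrite expRN ler_pdivrMr ?expR_gt0//.
    apply: (@le_trans _ _ (s ^+ N.+1)).
      rewrite -(powR_mulrn _ (ltW s0)) ler_powR ?(ltW s1)//.
      have := truncnS_gt a; rewrite -/N => aN; rewrite -natr1; lra.
    have := expR_ge1Dxn N (ltW (divr_gt0 s0 (ltr0Sn R 1))) => h.
    have : (s / 2) ^+ N.+1 / N.+1`!%:R <= expR (s / 2) by lra.
    rewrite ler_pdivrMr ?ltr0n ?fact_gt0// exprMn exprVn ler_pdivrMr ?exprn_gt0//.
    by move=> /le_trans; apply; rewrite -mulrA mulrC [X in X * _]mulrC.
rewrite ge0_integralZl//; last 2 first.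
- by apply/measurable_EFinP; exact: measurable_funTS.
- by move=> s _; rewrite lee_fin exponential_pdf_ge0.
apply: lte_mul_pinfty => //.
apply: (@le_lt_trans _ _ (\int[mu]_x (exponential_pdf 2^-1 x)%:E)%E).
  apply: ge0_subset_integral => //.
  - exact/measurable_EFinP.
  - by move=> s _; rewrite lee_fin exponential_pdf_ge0.
by rewrite integral_exponential_pdf ?ltry.
Qed.

End beta.

(** * The operator J and its adjoint on backward heat kernels *)

Lemma sigma_finite_spacetime (R : realType) (n : nat) :
  sigma_finite setT (@lebesgue_spacetime R n).
Proof.
have /sigma_finiteP[F [FT ndF mF]] := sigma_finiteT (@lebesgue_tuple R n).
have /sigma_finiteP[G [GT ndG mG]] := sigma_finiteT (@lebesgue_measure R).
exists (fun i => F i `*` G i).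
  apply/esym; rewrite -subTset => -[x t] _.
  have : [set: n.-tuple R] x by [].
  rewrite FT => -[i _ Fi].
  have : [set: R] t by [].
  rewrite GT => -[j _ Gj].
  exists (maxn i j) => //; split.
    by have /subsetPset := ndF _ _ (leq_maxl i j); exact.
  by have /subsetPset := ndG _ _ (leq_maxr i j); exact.
move=> i; have [mFi Fioo] := mF i; have [mGi Gioo] := mG i; split.
  exact: measurableX.
rewrite /lebesgue_spacetime product_measure1E//.
by rewrite lte_mul_pinfty ?measure_ge0// ge0_fin_numE ?measure_ge0.
Qed.

HB.instance Definition _ {R : realType} (n : nat) :=
  @Measure_isSigmaFinite.Build _ _ _ (@lebesgue_spacetime R n)
    (sigma_finite_spacetime R n).

#[global] Instance ae_spacetime_filter (R : realType) (n : nat) :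
  Filter (nbhs (almost_everywhere (@lebesgue_spacetime R n))).
Proof. exact: (@ae_filter_ringOfSetsType _ _ _ (@lebesgue_spacetime R n)). Qed.

Section spacetime.
Context {R : realType} {n : nat}.
Local Notation mu := (@lebesgue_measure R).
Local Notation X := (n.-tuple R * R)%type.
Local Notation nu := (@lebesgue_spacetime R n).
Implicit Types (f : X -> R) (z w : X) (a p t T S : R) (x y : n.-tuple R).

Lemma ge0_integral_spacetime (f : X -> \bar R) :
  measurable_fun setT f -> (forall z, 0 <= f z)%E ->
  (\int[nu]_z f z = \int[mu]_t \int[lebesgue_tuple n]_x f (x, t))%E.
Proof. by move=> mf f0; exact: fubini_tonelli2. Qed.

(* With T = S this is the space-time heat kernel of order p + 1 centred at
   (y, S), run backwards in time and without its Gamma factor. *)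
Definition bheat p T S y z : R := pw p (T - z.2) * gauss (S - z.2) (tuple_sub z.1 y).

Lemma bheat_ge0 p T S y z : 0 <= bheat p T S y z.
Proof. by rewrite mulr_ge0 ?pw_ge0 ?gauss_ge0. Qed.

Lemma measurable_bheat d (U : measurableType d) p (T S : U -> R)
    (y : U -> n.-tuple R) (z : U -> X) :
  measurable_fun setT T -> measurable_fun setT S ->
  measurable_fun setT y -> measurable_fun setT z ->
  measurable_fun setT (fun u => bheat p (T u) (S u) (y u) (z u)).
Proof.
move=> mT mS my mz.
have mz1 : measurable_fun setT (fun u => (z u).1) by exact: measurableT_comp.
have mz2 : measurable_fun setT (fun u => (z u).2) by exact: measurableT_comp.
apply: measurable_funM; first by apply: measurable_pw; exact: measurable_funB.
by apply: measurable_gauss; [exact: measurable_funB|exact: measurable_tuple_sub].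
Qed.

(** As a function of [z] this is a forward kernel issued from [w]; as a function of [w] it is a
    backward kernel with apex [z]. The double reading lets one integral identity serve for the
    adjoint of [J] and for [J] of the explicit source. *)
Definition fheat p w z : R := bheat p z.2 z.2 z.1 w.

Lemma fheatE p w z :
  fheat p w z = pw p (z.2 - w.2) * gauss (z.2 - w.2) (tuple_sub w.1 z.1).
Proof. by []. Qed.

Lemma fheat_ge0 p w z : 0 <= fheat p w z.
Proof. exact: bheat_ge0. Qed.

Lemma measurable_fheat d (U : measurableType d) p (w z : U -> X) :
  measurable_fun setT w -> measurable_fun setT z ->
  measurable_fun setT (fun u => fheat p (w u) (z u)).
Proof.
move=> mw mz; apply: measurable_bheat => //; exact: measurableT_comp.
Qed.

(** At time t the space integral merges Gaussians of times t - w.2 and S - t into one of time S -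
    w.2, which no longer depends on t; the time integral is then a beta integral. [T <= S] makes S -
    t positive wherever the power of T - t is nonzero. *)
Lemma integral_fheat_bheat a p T S y w : 0 < a -> -1 < p -> T <= S ->
  (\int[nu]_z (fheat (a - 1) w z * bheat p T S y z)%:E =
   (betaR a p * bheat (a + p) T S y w)%:E)%E.
Proof.
move=> a0 p1 TS; rewrite ge0_integral_spacetime; last 2 first.
- apply/measurable_EFinP; apply: measurable_funM.
    by apply: measurable_fheat.
  by apply: measurable_bheat.
- by move=> z; rewrite lee_fin mulr_ge0 ?fheat_ge0 ?bheat_ge0.
transitivity (\int[mu]_t ((pw (a - 1) (t - w.2) * pw p (T - t))%:E *
    (gauss (S - w.2) (tuple_sub w.1 y))%:E))%E.
  apply: eq_integral => t _.
  under eq_integral => x _.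
    rewrite fheatE /bheat/= gaussC mulrACA EFinM.
    over.
  rewrite ge0_integralZl//; last 3 first.
  - by apply/measurable_EFinP; apply: measurable_funM; apply: measurable_gauss => //;
      apply: measurable_tuple_sub.
  - by move=> x _; rewrite lee_fin mulr_ge0 ?gauss_ge0.
  - by rewrite lee_fin mulr_ge0 ?pw_ge0.
  have [wt|wt] := ltP w.2 t; last first.
    by rewrite [pw _ (t - _)]pw_neg ?subr_le0// mul0r !mul0e.
  have [tT|tT] := ltP t T; last first.
    by rewrite [pw p _]pw_neg ?subr_le0// mulr0 !mul0e.
  rewrite integral_gaussM ?subr_gt0//; last exact: lt_le_trans TS.
  by congr (_ * (gauss _ _)%:E)%E; ring.
rewrite ge0_integralZr//; last 3 first.
- by apply/measurable_EFinP; exact: measurable_beta_integrand.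
- by move=> t _; rewrite lee_fin mulr_ge0 ?pw_ge0.
- by rewrite lee_fin gauss_ge0.
by rewrite integral_beta// -EFinM /bheat mulrA.
Qed.

Lemma heat_kernelE a x t :
  heat_kernel a x t = (Gamma a)^-1 * (pw (a - 1) t * gauss t x).
Proof.
rewrite /heat_kernel /pw /gauss; case: ifPn => _; last by rewrite mul0r mulr0.
by rewrite -!mulrA mulrCA.
Qed.

Lemma heat_kernel_fheat a z w :
  heat_kernel a (tuple_sub z.1 w.1) (z.2 - w.2) =
  (Gamma a)^-1 * fheat (a - 1) w z.
Proof. by rewrite heat_kernelE fheatE gaussC. Qed.

(** The restriction to the past of [z] is absorbed into [pw], so that Tonelli can be used on the
    full product space. *)
Lemma J_fheat a f z :
  (J a f z = \int[nu]_w ((Gamma a)^-1 * (fheat (a - 1) w z * f w))%:E)%E.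
Proof.
rewrite /J integral_mkcond; apply: eq_integral => w _; rewrite patchE.
rewrite heat_kernel_fheat; case: ifPn => [_|]; first by rewrite -mulrA.
rewrite notin_setE => /negP; rewrite -leNgt => zw.
by rewrite fheatE pw_neg ?subr_le0// !mul0r mulr0.
Qed.

Section nonnegative.
Variables (a : R) (a0 : 0 < a).
Let G0 : 0 <= (Gamma a)^-1. Proof. by rewrite invr_ge0 ltW// Gamma_gt0. Qed.
Variable f : X -> R.
Hypotheses (mf : measurable_fun setT f) (f0 : forall z, 0 <= f z).

Let mK d (U : measurableType d) (w z : U -> X) :
  measurable_fun setT w -> measurable_fun setT z ->
  measurable_fun setT
    (fun u => ((Gamma a)^-1 * (fheat (a - 1) (w u) (z u) * f (w u)))%:E).
Proof.
move=> mw mz; apply/measurable_EFinP; apply: measurable_funM => //.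
by apply: measurable_funM; [exact: measurable_fheat|exact: measurableT_comp].
Qed.

Let K0 w z : (0 <= ((Gamma a)^-1 * (fheat (a - 1) w z * f w))%:E)%E.
Proof. by rewrite lee_fin mulr_ge0// mulr_ge0// fheat_ge0. Qed.

Lemma J_ge0 z : (0 <= J a f z)%E.
Proof. by rewrite J_fheat integral_ge0. Qed.

Lemma measurable_J : measurable_fun setT (J a f).
Proof.
rewrite (_ : J a f = fubini_F nu (fun q : X * X =>
    ((Gamma a)^-1 * (fheat (a - 1) q.2 q.1 * f q.2))%:E)); last first.
  by apply/funext => z; rewrite J_fheat.
by apply: measurable_fun_fubini_tonelli_F; first exact: mK.
Qed.

(** Tonelli moves [J] onto the test function, where [integral_fheat_bheat] evaluates its adjoint.
    Both sides may be infinite. *)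
Lemma J_duality p T S y : -1 < p -> T <= S ->
  (\int[nu]_z ((bheat p T S y z)%:E * J a f z) =
   ((Gamma a)^-1 * betaR a p)%:E *
     \int[nu]_w (f w * bheat (a + p) T S y w)%:E)%E.
Proof.
move=> p1 TS.
have mb : measurable_fun setT (bheat p T S y) by exact: measurable_bheat.
pose H (q : X * X) : \bar R :=
  (bheat p T S y q.1 * ((Gamma a)^-1 * (fheat (a - 1) q.2 q.1 * f q.2)))%:E.
transitivity (\int[nu]_z \int[nu]_w H (z, w))%E.
  apply: eq_integral => z _; rewrite J_fheat -ge0_integralZl//; last 2 first.
  - exact: mK.
  - by rewrite lee_fin bheat_ge0.
rewrite (@fubini_tonelli _ _ _ _ _ nu nu H).
- rewrite -ge0_integralZl//; last 3 first.
  + apply/measurable_EFinP; apply: measurable_funM => //.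
    exact: measurable_bheat.
  + by move=> w _; rewrite lee_fin mulr_ge0// bheat_ge0.
  + by rewrite lee_fin mulr_ge0// ltW// betaR_gt0.
  apply: eq_integral => w _ /=.
  transitivity (\int[nu]_z (((Gamma a)^-1 * f w)%:E *
      (fheat (a - 1) w z * bheat p T S y z)%:E))%E.
    by apply: eq_integral => z _; rewrite -EFinM; congr EFin; ring.
  rewrite ge0_integralZl//; last 3 first.
  + apply/measurable_EFinP; apply: measurable_funM => //.
    exact: measurable_fheat.
  + by move=> z _; rewrite lee_fin mulr_ge0 ?fheat_ge0 ?bheat_ge0.
  + by rewrite lee_fin mulr_ge0.
  by rewrite integral_fheat_bheat// -!EFinM; congr EFin; ring.
- apply/measurable_EFinP; apply: measurable_funM.
    exact: measurable_bheat.
  by apply/measurable_EFinP; exact: mK.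
- by move=> q; rewrite lee_fin mulr_ge0 ?bheat_ge0// -lee_fin K0.
Qed.

End nonnegative.

(** The kernel is nonnegative, so the positive and negative parts of the integrand are the kernel
    times those of [f]. *)
Lemma J_posneg a f z : 0 < a -> measurable_fun setT f ->
  (J a f z = J a (f^\+)%R z - J a (f^\-)%R z)%E.
Proof.
move=> a0 mf; rewrite !J_fheat integralE.
have K0 w : 0 <= (Gamma a)^-1 * fheat (a - 1) w z.
  by rewrite mulr_ge0 ?fheat_ge0// invr_ge0 ltW// Gamma_gt0.
have KA w (r : R) : (Gamma a)^-1 * (fheat (a - 1) w z * r) =
  (Gamma a)^-1 * fheat (a - 1) w z * r by rewrite mulrA.
congr (_ - _)%E; apply: eq_integral => w _; rewrite ?funeposE ?funenegE.
  rewrite -EFin_max; congr EFin; rewrite !KA /funrpos.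
  by rewrite maxr_pMr// mulr0.
rewrite -EFinN -EFin_max; congr EFin; rewrite !KA /funrneg.
by rewrite maxr_pMr// mulr0 mulrN.
Qed.

End spacetime.

(** * Nonexistence: the energy inequality and the vanishing of the mass *)

Section nonexistence.
Context {R : realType} {n : nat}.
Local Notation mu := (@lebesgue_measure R).
Local Notation X := (n.-tuple R * R)%type.
Local Notation nu := (@lebesgue_spacetime R n).

Lemma measurable_past (T : R) : measurable (past n T).
Proof.
rewrite (_ : past n T = setT `&` snd @^-1` `]-oo, T[%classic).
  by apply: measurable_snd => //; exact: measurable_itv.
by apply/seteqP; split=> z /=; rewrite /past/= in_itv/= ?setTI//; tauto.
Qed.

Definition window (T1 T : R) : set X := [set z | T1 <= z.2 < T].

Lemma measurable_window T1 T : measurable (window T1 T).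
Proof.
rewrite (_ : window T1 T = setT `&` snd @^-1` `[T1, T[%classic).
  by apply: measurable_snd => //; exact: measurable_itv.
by apply/seteqP; split=> z /=; rewrite /window/= in_itv/= ?setTI//; tauto.
Qed.

(** For t >= 0 this is where the test function is at least a constant times T^E: t <= T/2 keeps T -
    t large, and the bound on the squared distance keeps the exponential away from 0. Times below 0
    carry no mass of [f]. *)
Definition parabolic (y : n.-tuple R) (T : R) : set X :=
  [set z | sqr_norm (tuple_sub z.1 y) <= T /\ z.2 <= T / 2].

Lemma measurable_parabolic y T : measurable (parabolic y T).
Proof.
have h : measurable_fun setT (fun z : X => sqr_norm (tuple_sub z.1 y)).
  by apply: measurable_sqr_norm; exact: measurable_tuple_sub.
rewrite (_ : parabolic y T =
    (setT `&` (fun z : X => sqr_norm (tuple_sub z.1 y)) @^-1` `]-oo, T]%classic)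
    `&` (setT `&` snd @^-1` `]-oo, T / 2]%classic)).
  apply: measurableI.
    by apply: h => //; exact: measurable_itv.
  by apply: measurable_snd => //; exact: measurable_itv.
by apply/seteqP; split=> z /=; rewrite /parabolic/= !in_itv/=; tauto.
Qed.

(** The Gaussian has mass one in space at each time before S, so an additive level M held during
    time T costs just M T. *)
Lemma integral_gauss_time (S : R) (y : n.-tuple R) (k : R -> R) :
  measurable_fun setT k -> (forall t, 0 <= k t) -> (forall t, S <= t -> k t = 0) ->
  (\int[nu]_z (gauss (S - z.2) (tuple_sub z.1 y) * k z.2)%:E =
   \int[mu]_t (k t)%:E)%E.
Proof.
move=> mk k0 kS; rewrite ge0_integral_spacetime; last 2 first.
- apply/measurable_EFinP; apply: measurable_funM; last exact: measurableT_comp.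
  apply: measurable_gauss; first exact: measurable_funB.
  exact: measurable_tuple_sub.
- by move=> z; rewrite lee_fin mulr_ge0 ?gauss_ge0.
apply: eq_integral => t _ /=; under eq_integral do rewrite EFinM.
rewrite ge0_integralZr//; last 3 first.
- apply/measurable_EFinP; apply: measurable_gauss => //.
  exact: measurable_tuple_sub.
- by move=> x _; rewrite lee_fin gauss_ge0.
- by rewrite lee_fin.
have [St|tS] := leP S t; first by rewrite kS// mule0.
by rewrite integral_gauss ?subr_gt0// mul1e.
Qed.

(** Either w <= M, or (w/M)^(lam-1) >= 1. This replaces Young's inequality and leaves the level M
    free. *)
Lemma le_powR_split (lam M w : R) : 1 < lam -> 0 < M -> 0 <= w ->
  w <= M `^ (1 - lam) * w `^ lam + M.
Proof.
move=> lam1 M0 w0; have [wM|Mw] := leP w M.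
  by rewrite (le_trans wM)// lerDr mulr_ge0 ?powR_ge0.
rewrite (@le_trans _ _ (M `^ (1 - lam) * w `^ lam))//; last by rewrite lerDl ltW.
have w00 : 0 < w by rewrite (lt_trans M0).
rewrite (_ : w `^ lam = w * w `^ (lam - 1)); last first.
  by rewrite -[X in X * _](powRr1 w0) -powRD ?(gt_eqF w00) ?implybT//; congr powR; ring.
rewrite (_ : 1 - lam = - (lam - 1)); last by ring.
rewrite powRN mulrCA ler_peMr// mulrC ler_pdivlMr ?powR_gt0// mul1r.
by rewrite ge0_ler_powR// ?nnegrE ?subr_ge0 ltW.
Qed.

Section core.
Variables (alpha lambda : R) (f : X -> R) (u : X -> R) (y : n.-tuple R).
Hypotheses (alpha_gt0 : 0 < alpha) (lambda_gt1 : 1 < lambda).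
Let E := alpha * lambda / (lambda - 1) - n%:R / 2.
Hypothesis E1 : 1 <= E.
Hypotheses (mf : measurable_fun setT f) (f0 : forall z, 0 <= f z).
Hypothesis f_past : forall z, z.2 < 0 -> f z = 0.
Hypothesis f_X1 : forall T : R, (\int[nu]_(z in past n T) (f z)%:E < +oo)%E.
Hypothesis uJ : {ae nu, forall z, (u z)%:E = J alpha f z}.
Hypothesis u_past : {ae nu, forall z, z.2 < 0 -> u z = 0}.
Hypothesis uf : {ae nu, forall z, u z `^ lambda <= f z}.

Let p := alpha / (lambda - 1).
Let l10 : 0 < lambda - 1. Proof. by rewrite subr_gt0. Qed.
Let p0 : 0 < p. Proof. by rewrite divr_gt0. Qed.
Let ap : alpha + p = p * lambda.
Proof. by rewrite /p; field; rewrite gt_eqF. Qed.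
Let EE : alpha + p = E + n%:R / 2.
Proof. by rewrite /E /p; field; rewrite gt_eqF. Qed.
Let c := (Gamma alpha)^-1 * betaR alpha p.
Let pN1 : -1 < p. Proof. by rewrite (lt_trans _ p0)// ltrN10. Qed.
Let c0 : 0 < c.
Proof. by rewrite mulr_gt0 ?invr_gt0 ?Gamma_gt0// betaR_gt0. Qed.
Let c3 : R := ((4 * pi) `^ (n%:R / 2))^-1.
Let c3_gt0 : 0 < c3.
Proof. by rewrite invr_gt0 powR_gt0// mulr_gt0 ?pi_gt0. Qed.
(** The factors come from T - t >= T/2, from 2T - t <= 2T in the Gaussian prefactor, and from |x -
    y|^2 <= T <= 2T - t in its exponent. *)
Let c1 : R := 2^-1 `^ (alpha + p) * (2 `^ (n%:R / 2))^-1 * c3 * expR (- 1).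
Let c1_gt0 : 0 < c1.
Proof. by rewrite /c1 mulr_gt0 ?expR_gt0// mulr_gt0// mulr_gt0 ?invr_gt0 ?powR_gt0. Qed.

Let Psi T := bheat (alpha + p) T (2 * T) y.

Let Psi_ub T z : 0 < T -> 0 <= z.2 -> Psi T z <= c3 * T `^ E.
Proof.
move=> T0 z0; have [zT|Tz] := ltP z.2 T; last first.
  by rewrite /Psi /bheat pw_neg ?subr_le0// mul0r mulr_ge0 ?powR_ge0 ?ltW.
have S0 : 0 < 2 * T - z.2 by lra.
rewrite /Psi /bheat pw_pos ?subr_gt0//.
apply: (@le_trans _ _ (T `^ (alpha + p) * ((4 * pi * T) `^ (n%:R / 2))^-1)).
  apply: ler_pM; rewrite ?powR_ge0 ?gauss_ge0//.
    by apply: ge0_ler_powR; rewrite ?nnegrE; [rewrite addr_ge0 ?ltW|lra|lra|lra].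
  apply: (le_trans (gauss_le_peak _ _ _ S0)).
  rewrite lef_pV2 ?posrE ?powR_gt0 ?mulr_gt0 ?pi_gt0//.
  apply: ge0_ler_powR; rewrite ?nnegrE ?divr_ge0 ?mulr_ge0 ?pi_ge0 ?(ltW S0) ?(ltW T0)//.
  by rewrite ler_wpM2l ?mulr_ge0 ?pi_ge0//; lra.
rewrite EE powRD ?(gt_eqF T0) ?implybT// powRM ?mulr_ge0 ?pi_ge0 ?(ltW T0)//.
rewrite le_eqVlt; apply/orP; left; apply/eqP; rewrite /c3.
by field; rewrite !gt_eqF ?powR_gt0 ?mulr_gt0 ?pi_gt0.
Qed.

Let Psi_lb T z : 0 < T -> sqr_norm (tuple_sub z.1 y) <= T -> 0 <= z.2 <= T / 2 ->
  c1 * T `^ E <= Psi T z.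
Proof.
move=> T0 xT /andP[z0 zT]; have S0 : T <= 2 * T - z.2 by lra.
rewrite /Psi /bheat pw_pos; last by lra.
apply: (@le_trans _ _ ((T / 2) `^ (alpha + p) *
   (((4 * pi * (2 * T)) `^ (n%:R / 2))^-1 * expR (- 1)))).
  rewrite EE !powRM ?mulr_ge0 ?pi_ge0 ?(ltW T0)//.
  rewrite [T `^ (E + _)]powRD ?(gt_eqF T0) ?implybT// !invfM /c1 EE /c3.
  rewrite powRM ?pi_ge0// !invfM.
  rewrite le_eqVlt; apply/orP; left; apply/eqP.
  by field; rewrite !gt_eqF ?powR_gt0 ?pi_gt0.
apply: ler_pM; rewrite ?mulr_ge0 ?invr_ge0 ?powR_ge0 ?expR_ge0//.
  by apply: ge0_ler_powR; rewrite ?nnegrE; [rewrite addr_ge0 ?ltW|lra|lra|lra].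
apply: ler_pM; rewrite ?invr_ge0 ?powR_ge0 ?expR_ge0//.
  have S00 : 0 < 2 * T - z.2 by lra.
  rewrite lef_pV2 ?posrE ?powR_gt0 ?mulr_gt0 ?pi_gt0//.
  apply: ge0_ler_powR; rewrite ?nnegrE ?divr_ge0 ?mulr_ge0 ?pi_ge0 ?(ltW S00) ?(ltW T0)//.
  by rewrite ler_wpM2l ?mulr_ge0 ?pi_ge0//; lra.
rewrite ler_expR lerN2 ler_pdivrMr ?mul1r; last by lra.
by lra.
Qed.

Let mPsi T : measurable_fun setT (Psi T).
Proof. exact: measurable_bheat. Qed.

Let Psi0 T z : 0 <= Psi T z. Proof. exact: bheat_ge0. Qed.

Let mfPsi T : measurable_fun setT (fun z => (f z * Psi T z)%:E).
Proof. by apply/measurable_EFinP; apply: measurable_funM => //; exact: mPsi. Qed.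

(** Finiteness is what allows half of the left side of [energy] to be subtracted. *)
Let intPsi_lty T : 0 < T -> (\int[nu]_z (f z * Psi T z)%:E < +oo)%E.
Proof.
move=> T0.
apply: (@le_lt_trans _ _ ((c3 * T `^ E)%:E * \int[nu]_(z in past n T) (f z)%:E)%E);
  last first.
  by apply: lte_mul_pinfty => //; rewrite lee_fin mulr_ge0 ?powR_ge0 ?ltW.
have mp := measurable_past T.
rewrite -ge0_integralZl//; last 3 first.
- by apply/measurable_EFinP; exact: measurable_funTS.
- by move=> z _; rewrite lee_fin.
- by rewrite lee_fin mulr_ge0 ?powR_ge0 ?ltW.
rewrite [leRHS]integral_mkcond; apply: ge0_le_integral => //.
- by move=> z _; rewrite lee_fin mulr_ge0.
- exact: mfPsi.
- apply/(measurable_restrictT _ mp); apply: measurable_funeM.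
  by apply/measurable_EFinP; exact: measurable_funTS.
- move=> z _; rewrite patchE; case: ifPn => [_|].
    have [z0|z0] := ltP z.2 0; first by rewrite f_past// mul0r mule0.
    by rewrite -EFinM lee_fin mulrC ler_wpM2r// Psi_ub.
  rewrite notin_setE => /negP; rewrite -leNgt => Tz.
  by rewrite /Psi /bheat pw_neg ?subr_le0// mul0r mulr0.
Qed.

(** The solution of M0^(1 - lambda) = c/2: at this level the split costs half of the left side of
    [energy]. *)
Let M0 : R := (c / 2) `^ (1 - lambda)^-1.
Let c20 : 0 < c / 2. Proof. by apply: divr_gt0. Qed.
Let M0_gt0 : 0 < M0. Proof. exact: powR_gt0. Qed.
Let M0E : M0 `^ (1 - lambda) = c / 2.
Proof.
have l0 : 1 - lambda != 0 by rewrite lt_eqF// subr_lt0.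
by rewrite /M0 -powRrM mulVf// powRr1// ltW.
Qed.

(** The split is used at two levels. Before [T1] the level is [M0]: its power term is absorbed on
    the left and its additive price M0 T1 becomes negligible against T. From [T1] on the level [M]
    is free, and its possibly huge factor M^(1 - lambda) only meets the mass of [f] in the
    window. *)
Let energy T1 T M : 0 <= T1 <= T -> 0 < T -> 0 < M ->
  (c%:E * \int[nu]_z (f z * Psi T z)%:E <=
   (c / 2)%:E * \int[nu]_z (f z * Psi T z)%:E +
   ((M `^ (1 - lambda) * (c3 * T `^ E))%:E * \int[nu]_(z in window T1 T) (f z)%:E +
    (M0 * T1 + M * T)%:E))%E.
Proof.
move=> /andP[T10 T1T] T0 M_gt0.
rewrite /c -J_duality//; last by lra.
(* The additive levels as a function of time. Before [T1] both terms are present; the surplus M only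
   weakens the bound and makes the total M0 T1 + M T. *)
rewrite -/c; pose k (t : R) : R := M0 * \1_(`[0%R, T1[%classic) t + M * \1_(`[0%R, T[%classic) t.
have mk : measurable_fun setT k.
  by apply: measurable_funD; apply: measurable_funM => //; exact: measurable_indic.
have i0 (A : set R) (t : R) : 0 <= \1_A t :> R by rewrite indicE ler0n.
have k0 t : 0 <= k t by apply: addr_ge0; apply: mulr_ge0 => //; exact: ltW.
have -> : (M0 * T1 + M * T)%:E =
    (\int[nu]_z (gauss (2 * T - z.2) (tuple_sub z.1 y) * k z.2)%:E)%E.
  rewrite integral_gauss_time//; last first.
    move=> t Tt; rewrite /k !indicE !memNset ?mulr0 ?addr0//= in_itv/=;
      by apply/negP; rewrite negb_and -leNgt; apply/orP; right; lra.
  under eq_integral do rewrite EFinD !EFinM.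
  rewrite ge0_integralD//; last 4 first.
  - by move=> t _; rewrite -EFinM lee_fin mulr_ge0// ltW.
  - by apply: measurable_funeM; apply/measurable_EFinP; exact: measurable_indic.
  - by move=> t _; rewrite -EFinM lee_fin mulr_ge0// ltW.
  - by apply: measurable_funeM; apply/measurable_EFinP; exact: measurable_indic.
  rewrite !ge0_integralZl//; try by rewrite lee_fin ltW.
  all: try by apply/measurable_EFinP; exact: measurable_indic.
  rewrite !integral_indic//= !setIT !lebesgue_measure_itv/= !lte_fin T0.
  rewrite EFinD !EFinM; congr (_ + _)%E; congr (_ * _)%E; last by rewrite -EFinD subr0.
  by case: ltP => [_|T1le]; [rewrite -EFinD subr0|have -> : T1 = 0 by lra].
have mJ : measurable_fun setT (J alpha f) by exact: measurable_J.
have -> : (\int[nu]_(z in window T1 T) (f z)%:E =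
    \int[nu]_z ((fun z => (f z)%:E) \_ (window T1 T)) z)%E.
  exact: integral_mkcond.
have mr : measurable_fun setT ((fun z => (f z)%:E) \_ (window T1 T)).
  by apply/(measurable_restrictT _ (measurable_window _ _))/measurable_funTS/measurable_EFinP.
have r0 z : (0 <= ((fun z => (f z)%:E) \_ (window T1 T)) z)%E.
  by apply: erestrict_ge0 => w _; rewrite lee_fin.
have K0 : 0 <= M `^ (1 - lambda) * (c3 * T `^ E).
  by rewrite !mulr_ge0 ?powR_ge0 ?ltW.
have mg : measurable_fun setT (fun z : X => gauss (2 * T - z.2) (tuple_sub z.1 y) * k z.2).
  apply: measurable_funM; last exact: measurableT_comp.
  by apply: measurable_gauss; [exact: measurable_funB|exact: measurable_tuple_sub].
have c20' := ltW c20.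
have fPsi0 z : (0 <= (f z * Psi T z)%:E)%E by rewrite lee_fin mulr_ge0.
have gk0 z : (0 <= (gauss (2 * T - z.2) (tuple_sub z.1 y) * k z.2)%:E)%E.
  by rewrite lee_fin mulr_ge0 ?gauss_ge0.
have mgE : measurable_fun setT
  (fun z : X => (gauss (2 * T - z.2) (tuple_sub z.1 y) * k z.2)%:E).
  exact/measurable_EFinP.
have mfP := mfPsi T.
have mfP1 : measurable_fun setT (fun z => (c / 2)%:E * (f z * Psi T z)%:E)%E.
  exact: measurable_funeM.
have mr1 : measurable_fun setT (fun z => (M `^ (1 - lambda) * (c3 * T `^ E))%:E *
    ((fun z => (f z)%:E) \_ (window T1 T)) z)%E by exact: measurable_funeM.
have fPsi1 z : (0 <= (c / 2)%:E * (f z * Psi T z)%:E)%E by apply: mule_ge0.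
have r1 z : (0 <= (M `^ (1 - lambda) * (c3 * T `^ E))%:E *
    ((fun z => (f z)%:E) \_ (window T1 T)) z)%E by apply: mule_ge0.
rewrite -!ge0_integralZl// -ge0_integralD// -ge0_integralD//; last 2 first.
- by move=> z _; apply: adde_ge0.
- exact: emeasurable_funD.
apply: ae_ge0_le_integral => //.
- by move=> z _; apply: mule_ge0; [rewrite lee_fin bheat_ge0|exact: J_ge0].
- by apply: emeasurable_funM => //; apply/measurable_EFinP; exact: measurable_bheat.
- by move=> z _; apply: adde_ge0 => //; apply: adde_ge0.
- by apply: emeasurable_funD => //; exact: emeasurable_funD.
apply: filterS3 uJ u_past uf => z uz uz0 ufz _.
have u0 : 0 <= u z by rewrite -lee_fin uz J_ge0.
rewrite -uz; have [Tz|zT] := leP T z.2.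
  rewrite /bheat pw_neg ?subr_le0// mul0r mul0e.
  by apply: adde_ge0 => //; apply: adde_ge0.
have [z0|z0] := ltP z.2 0.
  rewrite uz0// mule0.
  by apply: adde_ge0 => //; apply: adde_ge0.
have Tz0 : 0 < T - z.2 by rewrite subr_gt0.
set G := gauss _ _; have G0 : 0 <= G by exact: gauss_ge0.
pose w := (T - z.2) `^ p * u z.
have w0 : 0 <= w by rewrite mulr_ge0 ?powR_ge0.
have wlam : G * w `^ lambda <= f z * Psi T z.
  have -> : w `^ lambda = (T - z.2) `^ (alpha + p) * u z `^ lambda.
    by rewrite /w powRM ?powR_ge0// -powRrM ap.
  have -> : Psi T z = (T - z.2) `^ (alpha + p) * G by rewrite /Psi /bheat pw_pos.
  rewrite mulrCA [leRHS]mulrCA ler_wpM2l ?powR_ge0//.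
  by rewrite [leRHS]mulrC ler_wpM2l.
have bE : bheat p T (2 * T) y z * u z = G * w.
  by rewrite /bheat pw_pos// -/G /w; ring.
rewrite -EFinM bE; have [zT1|T1z] := ltP z.2 T1.
  rewrite patchE memNset; last by move=> /= /andP[]; rewrite leNgt zT1.
  rewrite mule0 add0e -EFinM -EFinD lee_fin.
  have := le_powR_split _ _ _ lambda_gt1 M0_gt0 w0; rewrite M0E => h.
  apply: (@le_trans _ _ (c / 2 * (G * w `^ lambda) + G * M0)).
    by rewrite (mulrCA (c / 2) G) -mulrDr ler_wpM2l.
  apply: lerD; first by rewrite ler_wpM2l.
  rewrite ler_wpM2l// /k !indicE !mem_set/= ?in_itv/= ?z0 ?zT1//.
  by rewrite !mulr1 lerDl ltW.
rewrite patchE mem_set; last by rewrite /window/= T1z zT.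
rewrite -!EFinM -!EFinD lee_fin.
apply: (@le_trans _ _ (M `^ (1 - lambda) * (G * w `^ lambda) + G * M)).
  by rewrite (mulrCA (M `^ _) G) -mulrDr ler_wpM2l// le_powR_split.
apply: ler_wpDl; [by apply: mulr_ge0 => //; exact: mulr_ge0|apply: lerD].
  apply: (@le_trans _ _ (M `^ (1 - lambda) * (f z * Psi T z))).
    by rewrite ler_wpM2l ?powR_ge0.
  rewrite -[leRHS](mulrA (M `^ _)) ler_wpM2l ?powR_ge0// mulrC ler_wpM2r//.
  exact: Psi_ub.
rewrite ler_wpM2l// /k !indicE (mem_set (A := `[0%R, T[%classic))/= ?in_itv/= ?z0 ?zT//.
by rewrite mulr1 lerDr mulr_ge0 ?ler0n// ltW.
Qed.

Let mfE : measurable_fun setT (fun z => (f z)%:E).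
Proof. exact/measurable_EFinP. Qed.

Let int_fin (A : set X) T : measurable A -> A `<=` past n T ->
  (\int[nu]_(z in A) (f z)%:E \is a fin_num)%E.
Proof.
move=> mA AT; rewrite ge0_fin_numE; last first.
  by apply: integral_ge0 => z _; rewrite lee_fin.
apply: le_lt_trans (f_X1 T); apply: ge0_subset_integral => //.
- exact: measurable_past.
- exact: measurable_funTS.
- by move=> z _; rewrite lee_fin.
Qed.

Lemma mass_estimate : exists kappa K L : R, [/\ 0 < kappa, 0 <= K, 0 < L &
  forall T1 T M : R, 0 <= T1 <= T -> 1 <= T -> 0 < M ->
  kappa * fine (\int[nu]_(z in parabolic y T) (f z)%:E)%E <=
  M `^ (1 - lambda) * K *
    fine (\int[nu]_(z in window T1 T) (f z)%:E)%E + L * T1 / T + M].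
Proof.
exists (c / 2 * c1), c3, M0; split => //; [exact: mulr_gt0|exact: ltW|].
move=> T1 T M T1T T1le M_gt0; have T0 : 0 < T by rewrite (lt_le_trans _ T1le).
have /andP[T10 T1T'] := T1T.
have := energy T1 T M T1T T0 M_gt0.
have Ifin : (\int[nu]_z (f z * Psi T z)%:E \is a fin_num)%E.
  rewrite ge0_fin_numE ?intPsi_lty//.
  by apply: integral_ge0 => z _; rewrite lee_fin mulr_ge0.
have Wfin : (\int[nu]_(z in window T1 T) (f z)%:E \is a fin_num)%E.
  apply: (@int_fin _ T); first exact: measurable_window.
  by move=> z /= /andP[].
have Dfin : (\int[nu]_(z in parabolic y T) (f z)%:E \is a fin_num)%E.
  apply: (@int_fin _ T); first exact: measurable_parabolic.
  move=> z /= [_ zT]; rewrite /past/=; lra.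
have ID : ((c1 * T `^ E)%:E * \int[nu]_(z in parabolic y T) (f z)%:E <=
    \int[nu]_z (f z * Psi T z)%:E)%E.
  rewrite -ge0_integralZl//; last 4 first.
  - exact: measurable_parabolic.
  - exact: measurable_funTS.
  - by move=> z _; rewrite lee_fin.
  - by rewrite lee_fin mulr_ge0 ?powR_ge0 ?ltW.
  rewrite [leLHS]integral_mkcond; apply: ge0_le_integral => //.
  - move=> z _; apply: erestrict_ge0 => w _.
    by rewrite -EFinM lee_fin mulr_ge0// mulr_ge0 ?powR_ge0// ltW.
  - apply/(measurable_restrictT _ (measurable_parabolic _ _)); apply: measurable_funeM.
    exact: measurable_funTS.
  - exact: mfPsi.
  - move=> z _; rewrite patchE; case: ifPn => zD; last by rewrite lee_fin mulr_ge0.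
    move/set_mem : zD => [xT zT].
    have [z0|z0] := ltP z.2 0; first by rewrite f_past// mul0r mule0.
    by rewrite -EFinM lee_fin mulrC ler_wpM2l// Psi_lb// z0.
set DD := fine (\int[nu]_(z in parabolic y T) (f z)%:E)%E.
set W := fine (\int[nu]_(z in window T1 T) (f z)%:E)%E.
pose I := fine (\int[nu]_z (f z * Psi T z)%:E)%E.
move: ID; rewrite -(fineK Ifin) -(fineK Wfin) -(fineK Dfin) -/I -/W -/DD.
(* This is where [E1] enters: after division by T^E, the additive costs M T and M0 T1 are at most M
   and M0 T1 / T. *)
have TE : T <= T `^ E by rewrite -[leLHS](powRr1 (ltW T0)) ler_powR.
have TE0 : 0 < T `^ E by rewrite powR_gt0.
rewrite -!EFinM -!EFinD !lee_fin => ID h.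
have h1 : c / 2 * I <= M `^ (1 - lambda) * (c3 * T `^ E) * W + (M0 * T1 + M * T).
  by move: h; rewrite [c * I](_ : _ = c / 2 * I + c / 2 * I) ?lerD2l//; field.
have h2 : c / 2 * c1 * DD * T `^ E <=
    (M `^ (1 - lambda) * c3 * W + (M0 * T1 / T + M)) * T `^ E.
  rewrite -[c / 2 * c1 * DD * _]mulrA -[c / 2 * c1 * _]mulrA.
  rewrite (_ : c1 * (DD * T `^ E) = c1 * T `^ E * DD); last by ring.
  apply: (@le_trans _ _ (c / 2 * I)); first by rewrite ler_wpM2l// ltW.
  apply: (le_trans h1); rewrite mulrDl; apply: lerD.
    by rewrite le_eqVlt; apply/orP; left; apply/eqP; ring.
  rewrite mulrDl; apply: lerD.
    rewrite -[leLHS](divfK (lt0r_neq0 T0)) ler_wpM2l//.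
    by apply: divr_ge0; [apply: mulr_ge0 => //|]; exact: ltW.
  by rewrite ler_wpM2l// ltW.
by move: h2; rewrite ler_pM2r// addrA.
Qed.

End core.
End nonexistence.

Lemma ge0_integral_exhaust d (T : measurableType d) (R : realType)
    (m : {measure set T -> \bar R}) (F : (set T)^nat) (g : T -> \bar R) (e : R) :
  nondecreasing_seq F -> (forall k, measurable (F k)) -> \bigcup_k F k = setT ->
  measurable_fun setT g -> (forall x, 0 <= g x)%E ->
  (\int[m]_x g x < +oo)%E -> 0 < e ->
  exists N, forall k, (N <= k)%N ->
    fine (\int[m]_x g x) <= fine (\int[m]_(x in F k) g x) + e.
Proof.
move=> ndF mF FT mg g0 goo e0.
have : (\int[m]_(x in F k) g x @[k --> \oo] --> \int[m]_(x in \bigcup_k F k) g x)%E.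
  apply: ge0_nondecreasing_set_cvg_integral => //.
  by move=> k; exact: measurable_funTS.
rewrite FT => cg.
have fg : (\int[m]_x g x \is a fin_num)%E by rewrite ge0_fin_numE// integral_ge0.
have : fine (\int[m]_(x in F k) g x)%E @[k --> \oo] --> fine (\int[m]_x g x)%E.
  by apply: fine_cvg; rewrite fineK.
move=> /cvgrPdist_le /(_ _ e0)[N _ HN]; exists N => k Nk.
have /= := HN k Nk; rewrite ler_norml => /andP[_]; lra.
Qed.

Lemma integral_eq0_ae d (T : measurableType d) (R : realType)
    (m : {measure set T -> \bar R}) (g : T -> \bar R) :
  measurable_fun setT g -> (forall x, 0 <= g x)%E -> (\int[m]_x g x = 0)%E ->
  {ae m, forall x, g x = 0%E}.
Proof.
move=> mg g0 ig; have : (\int[m]_x `|g x| = 0)%E.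
  by rewrite -ig; apply: eq_integral => x _; rewrite gee0_abs.
move/(ae_eq_integral_abs _ measurableT mg) => [N [mN N0 AN]].
by exists N; split => // x /= gx; apply: AN => /= /(_ I)/= gx0.
Qed.

Section core.
Context {R : realType} {n : nat}.
Local Notation mu := (@lebesgue_measure R).
Local Notation X := (n.-tuple R * R)%type.
Local Notation nu := (@lebesgue_spacetime R n).
Variables (alpha lambda : R) (f : X -> R) (u : X -> R) (y : n.-tuple R).
Hypotheses (alpha_gt0 : 0 < alpha) (lambda_gt1 : 1 < lambda).
Hypothesis E1 : 1 <= alpha * lambda / (lambda - 1) - n%:R / 2.
Hypotheses (mf : measurable_fun setT f) (f0 : forall z, 0 <= f z).
Hypothesis f_past : forall z, z.2 < 0 -> f z = 0.
Hypothesis f_X1 : forall T : R, (\int[nu]_(z in past n T) (f z)%:E < +oo)%E.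
Hypothesis uJ : {ae nu, forall z, (u z)%:E = J alpha f z}.
Hypothesis u_past : {ae nu, forall z, z.2 < 0 -> u z = 0}.
Hypothesis uf : {ae nu, forall z, u z `^ lambda <= f z}.

Let mfE : measurable_fun setT (fun z => (f z)%:E).
Proof. exact/measurable_EFinP. Qed.

Let fE0 z : (0 <= (f z)%:E)%E. Proof. by rewrite lee_fin. Qed.

Local Notation D := (parabolic y).

Let nd_D : nondecreasing_seq (fun k => D k%:R).
Proof.
move=> i j ij; rewrite subsetEset => z [zi zi2].
have ij' : i%:R <= j%:R :> R by rewrite ler_nat.
by split; [exact: le_trans ij'|lra].
Qed.

Let D_T : \bigcup_k D k%:R = setT.
Proof.
rewrite -subTset => z _; pose M := Num.max (sqr_norm (tuple_sub z.1 y)) (2 * z.2).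
exists (Num.trunc M).+1 => //; have := truncnS_gt M; rewrite gt_max => /andP[M1 M2].
by split; [exact: ltW|rewrite ler_pdivlMr// mulrC ltW].
Qed.

Let nd_past : nondecreasing_seq (fun k => past n (k%:R : R)).
Proof.
move=> i j ij; rewrite subsetEset => z; rewrite /past/= => /lt_le_trans; apply.
by rewrite ler_nat.
Qed.

Let past_T : \bigcup_k past n (k%:R : R) = setT.
Proof.
rewrite -subTset => z _; exists (Num.trunc z.2).+1 => //; exact: truncnS_gt.
Qed.

Let mD k : measurable (D k%:R). Proof. exact: measurable_parabolic. Qed.
Let mpast k : measurable (past n (k%:R : R)). Proof. exact: measurable_past. Qed.

Let fin_past T : (\int[nu]_(z in past n T) (f z)%:E \is a fin_num)%E.
Proof. by rewrite ge0_fin_numE// integral_ge0. Qed.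

(** For T1 = T the window is empty; with M = 1 the mass of each parabolic region is at most (L + 1)
    / kappa, uniformly in T. *)
Lemma finite_mass : (\int[nu]_z (f z)%:E < +oo)%E.
Proof.
have [kappa [K [L [k0 K0 L0 H]]]] := mass_estimate _ _ _ _ y alpha_gt0 lambda_gt1 E1
  mf f0 f_past f_X1 uJ u_past uf.
have Dfin T : 0 <= T -> (\int[nu]_(z in D T) (f z)%:E \is a fin_num)%E.
  move=> T0; rewrite ge0_fin_numE ?integral_ge0//.
  apply: (@le_lt_trans _ _ (\int[nu]_(z in past n (T + 1)) (f z)%:E)%E) => //.
  apply: ge0_subset_integral => //.
  - exact: measurable_parabolic.
  - exact: measurable_past.
  - exact: measurable_funTS.
  - by move=> z [_ zT]; rewrite /past/=; lra.
have cv : (\int[nu]_(z in D k%:R) (f z)%:E @[k --> \oo] -->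
    \int[nu]_(z in \bigcup_k D k%:R) (f z)%:E)%E.
  apply: ge0_nondecreasing_set_cvg_integral => //.
  by move=> k; exact: measurable_funTS.
rewrite D_T in cv.
rewrite -(cvg_lim _ cv)//; apply: (@le_lt_trans _ _ (((L + 1) / kappa)%:E)); last exact: ltry.
apply: lime_le; first by apply/cvg_ex; eexists; exact: cv.
near=> k; have k1 : 1 <= k%:R :> R by rewrite ler1n; near: k; exists 1%N.
have kk : 0 <= (k%:R : R) <= k%:R by rewrite lexx ler0n.
have := H _ _ _ kk k1 ltr01.
have -> : window k%:R k%:R = set0 :> set X.
  by apply/seteqP; split => // z /= /andP[a b]; move: (le_lt_trans a b); rewrite ltxx.
rewrite integral_set0/= mulr0 add0r mulfK; last by rewrite gt_eqF// (lt_le_trans _ k1).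
move=> h.
by rewrite -(fineK (Dfin _ (ler0n _ k))) lee_fin ler_pdivlMr// mulrC.
Unshelve. all: by end_near. Qed.

(** The order of choices matters: M is fixed by the supposed mass, then T1 so late that the
    remaining mass compensates M^(1 - lambda), and finally T so large that L T1 / T is small and
    half of the mass lies in the parabolic region. *)
Lemma no_mass : (\int[nu]_z (f z)%:E = 0)%E.
Proof.
have [kappa [K [L [k0 K0 L0 H]]]] := mass_estimate _ _ _ _ y alpha_gt0 lambda_gt1 E1
  mf f0 f_past f_X1 uJ u_past uf.
have foo := finite_mass.
have ffin : (\int[nu]_z (f z)%:E \is a fin_num)%E by rewrite ge0_fin_numE// integral_ge0.
pose m := fine (\int[nu]_z (f z)%:E)%E.
have m0 : 0 <= m by rewrite fine_ge0// integral_ge0.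
rewrite -(fineK ffin) -/m; congr EFin; apply/eqP; rewrite eq_le m0 andbT leNgt.
apply/negP => m_gt0.
(* Each of the three terms on the right of the estimate will be at most M, while the left side is at
   least kappa m / 2 = 4 M. *)
pose M := kappa * m / 8; have M_gt0 : 0 < M by rewrite divr_gt0 ?mulr_gt0.
pose A := M `^ (1 - lambda) * K; have A0 : 0 <= A by rewrite mulr_ge0 ?powR_ge0.
pose e := M / (A + 1); have e0 : 0 < e by rewrite divr_gt0// ltr_wpDl.
have Ae : A * e <= M.
  by rewrite /e mulrA ler_pdivrMr ?ltr_wpDl// mulrC ler_wpM2l ?lerDl ?ltW.
have [N1 HN1] := ge0_integral_exhaust _ _ _ nu _ _ e nd_past mpast past_T mfE fE0 foo e0.
have m20 : 0 < m / 2 by rewrite divr_gt0.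
have [N2 HN2] := ge0_integral_exhaust _ _ _ nu _ _ _ nd_D mD D_T mfE fE0 foo m20.
pose T1 : R := N1%:R.
pose k := (N1 + N2 + 1 + (Num.trunc (L * T1 / M)).+1)%N.
pose T : R := k%:R.
have T1T : 0 <= T1 <= T by rewrite ler0n /T1 /T ler_nat /k -!addnA leq_addr.
have T_1 : 1 <= T by rewrite /T ler1n /k addn_gt0 addn1.
have T0 : 0 < T by rewrite (lt_le_trans _ T_1).
have LT : L * T1 / T <= M.
  rewrite ler_pdivrMr// [leRHS]mulrC -ler_pdivrMr// ltW// (lt_le_trans (truncnS_gt _))//.
  by rewrite /T ler_nat /k leq_addl.
have := H _ _ _ T1T T_1 M_gt0; rewrite -/A.
have mW := @measurable_window R n T1 T.
have Wfin : (\int[nu]_(z in window T1 T) (f z)%:E \is a fin_num)%E.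
  rewrite ge0_fin_numE ?integral_ge0// (le_lt_trans _ foo)//.
  by apply: ge0_subset_integral.
have W_le : fine (\int[nu]_(z in window T1 T) (f z)%:E)%E <= e.
  have : (\int[nu]_(z in past n T1) (f z)%:E + \int[nu]_(z in window T1 T) (f z)%:E <=
      \int[nu]_z (f z)%:E)%E.
    rewrite -ge0_integral_setU//; last 3 first.
    - exact: measurable_past.
    - exact: measurable_funTS.
    - apply/disj_setPS => z [/= za /andP[zb _]].
      by move: (lt_le_trans za zb); rewrite ltxx.
    apply: ge0_subset_integral => //; apply: measurableU => //; exact: measurable_past.
  rewrite -(fineK ffin) -(fineK Wfin) -(fineK (fin_past T1)) -EFinD lee_fin.
  by have := HN1 N1 (leqnn _); rewrite -/T1; lra.
have Dm : m / 2 <= fine (\int[nu]_(z in D T) (f z)%:E)%E.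
  have := HN2 k; rewrite -/T -/m => /(_ _); rewrite /k.
  by move=> /(_ ltac:(by rewrite -addnA [(N1 + N2)%N]addnC -addnA leq_addr)); lra.
set W := fine _ in W_le *; set DD := fine _ in Dm * => h.
have h1 : kappa * (m / 2) <= kappa * DD by rewrite ler_wpM2l// ltW.
have h2 : A * W <= A * e by rewrite ler_wpM2l.
have M8 : kappa * m = 8 * M by rewrite /M; field.
have km : 0 < kappa * m by rewrite mulr_gt0.
lra.
Qed.

End core.

(** * Moments against truncated powers and the descent to order zero *)

Section positive_power_increments.
Context {R : realType}.

(** A convex function lies above its tangents. For positive x and y and b > 0 this is Young's
    inequality for x and y^b with exponents b + 1 and (b + 1)/b; b = 0 is separate because the
    second exponent degenerates. *)
Lemma pw_tangent (b x y : R) : 0 <= b ->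
  pw (b + 1) y + (b + 1) * pw b y * (x - y) <= pw (b + 1) x.
Proof.
move=> b0; have b1 : 0 < b + 1 by rewrite ltr_wpDl.
have [y0|y0] := leP y 0; first by rewrite !(pw_neg _ y)// mulr0 mul0r addr0 pw_ge0.
have yE : pw (b + 1) y = pw b y * y.
  by rewrite -pwM pw1 max_l// ltW.
have [x0|x0] := leP x 0.
  rewrite (pw_neg _ x)// yE [leLHS](_ : _ = pw b y * (y + (b + 1) * (x - y))); last by ring.
  apply: mulr_ge0_le0; first exact: pw_ge0.
  have : b * (x - y) <= 0 by apply: mulr_ge0_le0 => //; lra.
  by rewrite mulrDl mul1r; lra.
have [b00|b00] := eqVneq b 0.
  rewrite b00 add0r !pw1 pw_pos// powRr0 max_l; last exact: ltW.
  by rewrite max_l; [lra|exact: ltW].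
have bp : 0 < b by rewrite lt0r b00.
have := @conjugate_powR R x (y `^ b) (b + 1) ((b + 1) / b) (ltW x0) (powR_ge0 _ _)
  b1 (divr_gt0 b1 bp).
rewrite invf_div -powRrM (_ : b * ((b + 1) / b) = b + 1); last by field; rewrite gt_eqF.
rewrite (_ : (b + 1)^-1 + b / (b + 1) = 1); last by field; rewrite gt_eqF.
move=> /(_ erefl) h; rewrite yE !pw_pos//.
have yb : y `^ (b + 1) = y `^ b * y.
  by rewrite -!pw_pos// -yE pw_pos.
move: h; rewrite yb -(ler_pM2r b1) => h.
have -> : x `^ (b + 1) = (x `^ (b + 1) / (b + 1) + y `^ b * y * (b / (b + 1))) * (b + 1)
    - y `^ b * y * b by field; rewrite !gt_eqF.
by rewrite lerBrDr (le_trans _ h)// le_eqVlt; apply/orP; left; apply/eqP; ring.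
Qed.

Lemma pw_increment_ge (b h s : R) : 0 <= b ->
  (b + 1) * h * pw b (s - h) <= pw (b + 1) s - pw (b + 1) (s - h).
Proof. by move=> b0; have := pw_tangent b s (s - h) b0; lra. Qed.

Lemma pw_increment_le (b h s : R) : 0 <= b ->
  pw (b + 1) s - pw (b + 1) (s - h) <= (b + 1) * h * pw b s.
Proof. by move=> b0; have := pw_tangent b (s - h) s b0; lra. Qed.

(** Only the left limit is used because [pw 0] jumps at 0, where its value 0 agrees with the limit
    from below. *)
Lemma pw_left_continuous (b s : R) :
  pw b (s - k.+1%:R^-1) @[k --> \oo] --> pw b s.
Proof.
have sk : s - k.+1%:R^-1 @[k --> \oo] --> s.
  rewrite -[X in _ --> X]subr0; apply: cvgB; first exact: cvg_cst.
  exact: cvg_harmonic.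
have [s0|s0] := leP s 0.
  rewrite [X in _ --> X]pw_neg//; apply: cvg_near_cst; apply: nearW => k.
  by rewrite pw_neg// (le_trans _ s0)// gerBl.
have cs : {for s, continuous (@powR R ^~ b)}.
  apply: differentiable_continuous; apply/derivable1_diffP.
  by apply: derivable_powR; rewrite in_itv/= s0.
rewrite pw_pos//.
apply: (@cvg_trans _ ((s - k.+1%:R^-1) `^ b @[k --> \oo])); last exact: (cvg_comp _ _ sk cs).
apply: near_eq_cvg; near=> k; rewrite pw_pos//.
by near: k; move/cvgr_gt : sk; apply.
Unshelve. all: by end_near. Qed.

End positive_power_increments.

Section moments.
Context {d} {U : measurableType d} {R : realType}.
Variables (m : {sigma_finite_measure set U -> \bar R}) (theta : U -> R).
Hypothesis mtheta : measurable_fun setT theta.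
Local Notation mu := (@lebesgue_measure R).
Implicit Types (g : U -> R) (b h S T : R).

(** Up to a Gamma factor, the Riemann-Liouville integral of order b + 1 of the image of g m under
    [theta]; for b = 0 it is the mass of {theta < T}. *)
Definition moment g b T : \bar R := \int[m]_z (g z * pw b (T - theta z))%:E.

(** The difference is taken under the integral, so it is meaningful even where both moments are
    infinite, as may happen at order 1 in [moment_inversion]. *)
Definition moment_incr g b h T : \bar R :=
  \int[m]_z (g z * (pw b (T - theta z) - pw b (T - h - theta z)))%:E.

Lemma pw_incr_ge0 b h s t : 0 <= b -> 0 <= h -> 0 <= pw b (s - t) - pw b (s - h - t) :> R.
Proof. by move=> b0 h0; rewrite subr_ge0 ler_pw//; lra. Qed.

Lemma measurable_moment g b T : measurable_fun setT g ->
  measurable_fun setT (fun z => (g z * pw b (T - theta z))%:E).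
Proof.
move=> mg; apply/measurable_EFinP; apply: measurable_funM => //.
by apply: measurable_pw; exact: measurable_funB.
Qed.

Lemma measurable_moment_incr g b h T : measurable_fun setT g ->
  measurable_fun setT
    (fun z => (g z * (pw b (T - theta z) - pw b (T - h - theta z)))%:E).
Proof.
move=> mg; apply/measurable_EFinP; apply: measurable_funM => //.
by apply: measurable_funB; apply: measurable_pw; exact: measurable_funB.
Qed.

Section one.
Variables (g : U -> R) (mg : measurable_fun setT g) (g0 : forall z, 0 <= g z).

Lemma moment_ge0 b T : (0 <= moment g b T)%E.
Proof. by apply: integral_ge0 => z _; rewrite lee_fin mulr_ge0 ?pw_ge0. Qed.

Lemma moment_incrE b h T : 0 <= b -> 0 <= h -> (moment g b (T - h) < +oo)%E ->
  moment_incr g b h T = (moment g b T - moment g b (T - h))%E.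
Proof.
move=> b0 h0 foo.
rewrite (_ : moment g b T = moment_incr g b h T + moment g b (T - h))%E.
  by rewrite addeK// ge0_fin_numE ?moment_ge0.
rewrite -ge0_integralD//.
- by apply: eq_integral => z _; rewrite -EFinD -mulrDr subrK.
- by move=> z _; rewrite lee_fin mulr_ge0 ?pw_incr_ge0.
- exact: measurable_moment_incr.
- by move=> z _; rewrite lee_fin mulr_ge0 ?pw_ge0.
- exact: measurable_moment.
Qed.

(** Where theta < T, the extra factor T' - theta is at least T' - T. Lowering the order therefore
    costs a strictly earlier time. *)
Lemma moment_lty b T T' : T < T' ->
  (moment g (b + 1) T' < +oo)%E -> 0 <= b -> (moment g b T < +oo)%E.
Proof.
move=> TT foo b0; have d0 : 0 < T' - T by rewrite subr_gt0.
apply: (@le_lt_trans _ _ ((T' - T)^-1%:E * moment g (b + 1) T')%E); last first.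
  by apply: lte_mul_pinfty; rewrite ?lee_fin ?invr_ge0 ?ltW.
rewrite -ge0_integralZl//; last 3 first.
- exact: measurable_moment.
- by move=> z _; rewrite lee_fin mulr_ge0 ?pw_ge0.
- by rewrite lee_fin invr_ge0 ltW.
apply: ge0_le_integral => //.
- by move=> z _; rewrite lee_fin mulr_ge0 ?pw_ge0.
- exact: measurable_moment.
- by apply: measurable_funeM; exact: measurable_moment.
- move=> z _; rewrite -EFinM lee_fin mulrCA ler_wpM2l// ler_pdivlMl//.
  have [t0|t0] := leP (T - theta z) 0; first by rewrite pw_neg// mulr0 pw_ge0.
  rewrite -pwM [leRHS]mulrC; apply: ler_pM; [exact: ltW|exact: pw_ge0| |].
    by rewrite pw1 le_max; apply/orP; left; lra.
  by apply: ler_pw => //; lra.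
Qed.

End one.

(** By convexity, the increment of order b + 1 lies between (b + 1) h times the moments of order b
    at T - h and at T. This compares g1 at T - h with g2 at T; then h -> 0 by monotone convergence,
    with no differentiation under the integral. *)
Lemma moment_lowering_le g1 g2 b T :
  measurable_fun setT g1 -> measurable_fun setT g2 ->
  (forall z, 0 <= g1 z) -> (forall z, 0 <= g2 z) -> 0 <= b ->
  (forall h, 0 < h -> moment_incr g1 (b + 1) h T = moment_incr g2 (b + 1) h T) ->
  (moment g1 b T <= moment g2 b T)%E.
Proof.
move=> mg1 mg2 g10 g20 b0 H; have b1 : 0 < b + 1 by rewrite ltr_wpDl.
have key h : 0 < h -> (moment g1 b (T - h) <= moment g2 b T)%E.
  move=> h0; have bh : 0 < (b + 1) * h by rewrite mulr_gt0.
  rewrite -(@lee_pmul2l _ ((b + 1) * h)%:E)//.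
  rewrite -!ge0_integralZl//; try exact: measurable_moment;
    try (by move=> z _; rewrite lee_fin mulr_ge0 ?pw_ge0);
    try by rewrite lee_fin ltW.
  apply: (@le_trans _ _ (moment_incr g1 (b + 1) h T)).
    apply: ge0_le_integral => //.
    - move=> z _; rewrite -EFinM lee_fin; apply: mulr_ge0; first exact: ltW.
      by apply: mulr_ge0 => //; exact: pw_ge0.
    - by apply: measurable_funeM; exact: measurable_moment.
    - exact: measurable_moment_incr.
    - move=> z _; rewrite -EFinM lee_fin mulrCA ler_wpM2l//.
      have := pw_increment_ge b h (T - theta z) b0.
      by rewrite (_ : T - theta z - h = T - h - theta z)//; ring.
  rewrite H//; apply: ge0_le_integral => //.
  - by move=> z _; rewrite lee_fin mulr_ge0// pw_incr_ge0// ltW.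
  - exact: measurable_moment_incr.
  - by apply: measurable_funeM; exact: measurable_moment.
  - move=> z _; rewrite -EFinM lee_fin [leRHS]mulrCA ler_wpM2l//.
    have := pw_increment_le b h (T - theta z) b0.
    by rewrite (_ : T - theta z - h = T - h - theta z)//; ring.
have cv : (moment g1 b (T - k.+1%:R^-1) @[k --> \oo] --> moment g1 b T)%E.
  apply: cvg_toP; last first.
    rewrite /moment -monotone_convergence//; last 3 first.
    - by move=> k; exact: measurable_moment.
    - by move=> k z _; rewrite lee_fin mulr_ge0 ?pw_ge0.
    - move=> z _ i j ij; rewrite lee_fin ler_wpM2l// ler_pw// lerD2r lerD2l lerN2.
      by rewrite lef_pV2 ?posrE// ler_nat.
    apply: eq_integral => z _; apply/cvg_lim => //; apply: cvg_EFin.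
      exact: nearW.
    rewrite (_ : fine \o _ = fun k => g1 z * pw b (T - theta z - k.+1%:R^-1)); last first.
      by apply/funext => k /=; congr (_ * pw _ _); ring.
    by apply: cvgMr; exact: pw_left_continuous.
  apply: ereal_nondecreasing_is_cvgn => i j ij; apply: ge0_le_integral => //.
  - by move=> z _; rewrite lee_fin mulr_ge0 ?pw_ge0.
  - exact: measurable_moment.
  - exact: measurable_moment.
  - move=> z _; rewrite lee_fin ler_wpM2l// ler_pw// lerD2r lerD2l lerN2.
    by rewrite lef_pV2 ?posrE// ler_nat.
rewrite -(cvg_lim _ cv)//; apply: lime_le.
  by apply/cvg_ex; eexists; exact: cv.
by apply: nearW => k; apply: key.
Qed.

(** Integrating against (T - r)_+^(-b) raises the order by 1 - b, by the beta integral and Tonelli.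
    Increments are nondecreasing powers minus their shifts, so all integrands remain nonnegative. *)
Lemma moment_incr_fractional g b h T : measurable_fun setT g ->
  (forall z, 0 <= g z) -> 0 < b < 1 -> 0 < h ->
  ((betaR (b + 1) (- b))%:E * moment_incr g 1 h T =
   \int[mu]_r ((pw (- b) (T - r))%:E * moment_incr g b h r))%E.
Proof.
move=> mg g0 /andP[b0 b1] h0; set c := betaR _ _.
have bN : -1 < - b by lra.
have b10 : 0 < b + 1 by lra.
have c0 : 0 < c by exact: betaR_gt0.
have mr (t : R) : measurable_fun setT (fun r : R => (pw (- b) (T - r) *
    (pw b (r - t) - pw b (r - h - t)))%:E).
  apply/measurable_EFinP; apply: measurable_funM.
    by apply: measurable_pw; exact: measurable_funB.
  apply: measurable_funB; apply: measurable_pw; apply: measurable_funB => //.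
  exact: measurable_funB.
have beta1 t : (\int[mu]_r (pw (- b) (T - r) * (pw b (r - t) - pw b (r - h - t)))%:E =
    (c * (pw 1 (T - t) - pw 1 (T - h - t)))%:E)%E.
  have I s : (\int[mu]_r (pw (- b) (T - r) * pw b (r - s))%:E =
      (c * pw 1 (T - s))%:E)%E.
    rewrite /c -[X in pw X _](_ : b + 1 + - b = 1); last by ring.
    rewrite -(integral_beta _ _ s T b10 bN).
    by apply: eq_integral => r _; rewrite addrK mulrC.
  rewrite mulrBr EFinB -I (_ : T - h - t = T - (t + h)); last by ring.
  rewrite -I.
  have -> : (\int[mu]_r (pw (- b) (T - r) * pw b (r - t))%:E =
     \int[mu]_r (pw (- b) (T - r) * (pw b (r - t) - pw b (r - h - t)))%:E +
     \int[mu]_r (pw (- b) (T - r) * pw b (r - (t + h)))%:E)%E.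
    rewrite -ge0_integralD//.
    - apply: eq_integral => r _; rewrite -EFinD -mulrDr.
      by congr (_ * _)%:E; rewrite (_ : r - h - t = r - (t + h)) ?subrK//; ring.
    - by move=> r _; rewrite lee_fin mulr_ge0 ?pw_ge0// pw_incr_ge0// ltW.
    - exact: mr.
    - by move=> r _; rewrite lee_fin mulr_ge0 ?pw_ge0.
    - by apply/measurable_EFinP; apply: measurable_funM; apply: measurable_pw;
        exact: measurable_funB.
  by rewrite addeK// I.
pose H (q : U * R) : \bar R := (g q.1 * (pw (- b) (T - q.2) *
  (pw b (q.2 - theta q.1) - pw b (q.2 - h - theta q.1))))%:E.
have mt1 : measurable_fun setT (fun q : U * R => theta q.1).
  by apply: measurableT_comp.
have mH : measurable_fun setT H.
  apply/measurable_EFinP; apply: measurable_funM; first exact: measurableT_comp.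
  apply: measurable_funM; first by apply: measurable_pw; exact: measurable_funB.
  apply: measurable_funB; apply: measurable_pw; apply: measurable_funB => //.
  exact: measurable_funB.
have H0 q : (0 <= H q)%E.
  by rewrite lee_fin mulr_ge0// mulr_ge0 ?pw_ge0// pw_incr_ge0// ltW.
rewrite -ge0_integralZl//; last 3 first.
- exact: measurable_moment_incr.
- by move=> z _; rewrite lee_fin mulr_ge0// pw_incr_ge0// ltW.
- by rewrite lee_fin ltW.
transitivity (\int[m]_z \int[mu]_r H (z, r))%E.
  apply: eq_integral => z _; rewrite /H/=.
  under [RHS]eq_integral do rewrite EFinM.
  rewrite ge0_integralZl//; last 3 first.
  - exact: mr.
  - by move=> r _; rewrite lee_fin mulr_ge0 ?pw_ge0// pw_incr_ge0// ltW.
  - by rewrite lee_fin.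
  by rewrite beta1 -!EFinM; congr EFin; ring.
rewrite (@fubini_tonelli _ _ _ _ _ m mu H)//; apply: eq_integral => r _.
rewrite -ge0_integralZl//; last 3 first.
- exact: measurable_moment_incr.
- by move=> z _; rewrite lee_fin mulr_ge0// pw_incr_ge0// ltW.
- by rewrite lee_fin pw_ge0.
by apply: eq_integral => z _; rewrite /H/= -EFinM mulrCA.
Qed.

(** Convexity brings the order from k + b down to b; fractional integration lifts the increments
    from order b to order 1; one more lowering reaches order 0. *)
Lemma moment_inversion g1 g2 S b (k : nat) :
  measurable_fun setT g1 -> measurable_fun setT g2 ->
  (forall z, 0 <= g1 z) -> (forall z, 0 <= g2 z) -> 0 < b < 1 ->
  (forall T, T < S -> moment g1 (k%:R + b) T = moment g2 (k%:R + b) T) ->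
  (forall T, T < S -> (moment g1 (k%:R + b) T < +oo)%E) ->
  forall T, T < S -> moment g1 0 T = moment g2 0 T.
Proof.
move=> mg1 mg2 g10 g20 b01; have /andP[b0 b1] := b01.
elim: k => [|k IH] eqm foo.
  move=> T TS.
  have eqi h r : 0 < h -> r < S -> moment_incr g1 b h r = moment_incr g2 b h r.
    move=> h0 rS; have rhS : r - h < S by lra.
    have e1 := eqm _ rS; have e2 := eqm _ rhS; have f1 := foo _ rhS.
    rewrite !add0r in e1 e2 f1.
    by rewrite !moment_incrE// ?e1 ?e2 -?e2// ltW.
  have c0 : 0 < betaR (b + 1) (- b) by apply: betaR_gt0; lra.
  have eq1 h : 0 < h -> moment_incr g1 (0 + 1) h T = moment_incr g2 (0 + 1) h T.
    move=> h0; rewrite add0r; have := @moment_incr_fractional g1 b h T mg1 g10 b01 h0.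
    have -> : (\int[mu]_r ((pw (- b) (T - r))%:E * moment_incr g1 b h r) =
               \int[mu]_r ((pw (- b) (T - r))%:E * moment_incr g2 b h r))%E.
      apply: eq_integral => r _; have [rT|Tr] := ltP r T.
        by rewrite eqi// (lt_trans rT).
      by rewrite pw_neg ?subr_le0// !mul0e.
    rewrite -(@moment_incr_fractional g2 b h T mg2 g20 b01 h0).
    move/(congr1 (fun x => ((betaR (b + 1) (- b))^-1%:E * x)%E)).
    by rewrite !muleA -!EFinM mulVf ?gt_eqF// !mul1e.
  apply/eqP; rewrite eq_le; apply/andP; split; apply: moment_lowering_le => // h h0.
  by rewrite eq1.
have kb0 : 0 <= k%:R + b by rewrite addr_ge0// ltW.
have kE : k.+1%:R + b = k%:R + b + 1 by rewrite -natr1; ring.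
rewrite kE in eqm foo.
apply: IH => T TS.
  have eqi h : 0 < h -> moment_incr g1 (k%:R + b + 1) h T = moment_incr g2 (k%:R + b + 1) h T.
    move=> h0; have ThS : T - h < S by lra.
    have kb1 : 0 <= k%:R + b + 1 by rewrite addr_ge0.
    have f1 := foo _ ThS; have f2 := f1; rewrite (eqm _ ThS) in f2.
    rewrite (@moment_incrE g1 mg1 g10 _ _ _ kb1 (ltW h0) f1).
    by rewrite (@moment_incrE g2 mg2 g20 _ _ _ kb1 (ltW h0) f2) (eqm _ TS) (eqm _ ThS).
  apply/eqP; rewrite eq_le; apply/andP; split; apply: moment_lowering_le => // h h0.
  by rewrite eqi.
(* The later time needed by [moment_lty] must still precede S, hence the midpoint. *)
apply: (@moment_lty g1 mg1 g10 _ T ((T + S) / 2)) => //; first by lra.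
by apply: foo; lra.
Qed.

End moments.

(** * Densities are determined by their integrals over orthants *)

Section density.
Context {d} {T : measurableType d} {R : realType} (m : {measure set T -> \bar R}).
Variables (f : T -> R) (mf : measurable_fun setT f) (f0 : forall z, 0 <= f z).

Definition density (A : set T) : \bar R := \int[m]_(z in A) (f z)%:E.

Let density0 : density set0 = 0%E. Proof. exact: integral_set0. Qed.

Let density_ge0 A : (0 <= density A)%E.
Proof. by apply: integral_ge0 => z _; rewrite lee_fin. Qed.

Let density_sigma_additive : semi_sigma_additive density.
Proof.
move=> F mF tF mUF; rewrite /density ge0_integral_bigcup//.
- apply: is_cvg_ereal_nneg_natsum_cond => k _ _.
  by apply: integral_ge0 => z _; rewrite lee_fin.
- by apply: measurable_funTS; exact/measurable_EFinP.
- by move=> z _; rewrite lee_fin.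
Qed.

Definition density_measure : {measure set T -> \bar R} :=
  HB.pack density (isMeasure.Build _ _ _ density density0 density_ge0
    density_sigma_additive).

End density.

Section orthants.
Context {R : realType} {n : nat}.
Local Notation mu := (@lebesgue_measure R).
Local Notation X := (n.-tuple R * R)%type.
Local Notation nu := (@lebesgue_spacetime R n).
Implicit Types (a : 'I_n -> R) (T : R) (z : X).

Definition orthant a T : set X := [set z | (forall i, tnth z.1 i < a i) /\ z.2 < T].

Lemma measurable_coord (i : 'I_n) : measurable_fun setT (fun z : X => tnth z.1 i).
Proof.
by apply: (measurableT_comp (f := fun x : n.-tuple R => tnth x i)) => //; exact: measurable_tnth.
Qed.

Lemma measurable_orthant a T : measurable (orthant a T).
Proof.
rewrite (_ : orthant a T = past n T `&` \bigcap_(i in [set: 'I_n])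
    (setT `&` (fun z : X => tnth z.1 i) @^-1` `]-oo, a i[%classic)).
  apply: measurableI; first exact: measurable_past.
  apply: fin_bigcap_measurable; first exact: finite_finset.
  by move=> i _; apply: measurable_coord => //; exact: measurable_itv.
apply/seteqP; split=> z.
  move=> [za zT]; split => // i _; split => //=; rewrite in_itv/=; exact: za.
move=> [zT za]; split => // i; have [_] := za i I.
by rewrite /= in_itv.
Qed.

Let G : set (set X) := [set A | exists a T, A = orthant a T].

Let G_setI : setI_closed G.
Proof.
move=> _ _ [a [T ->]] [b [S ->]].
exists (fun i => Num.min (a i) (b i)), (Num.min T S); apply/seteqP; split => z /=.
  move=> [[za zT] [zb zS]]; split=> [i|]; rewrite lt_min; last by rewrite zT zS.
  by rewrite za zb.
move=> [zab zTS]; split; split => [i|].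
- by have := zab i; rewrite lt_min => /andP[].
- by move: zTS; rewrite lt_min => /andP[].
- by have := zab i; rewrite lt_min => /andP[].
- by move: zTS; rewrite lt_min => /andP[].
Qed.

Lemma coord_ub z : exists k, forall i, tnth z.1 i < k%:R.
Proof.
have : \forall k \near \oo, forall i : 'I_n, tnth z.1 i < k%:R.
  apply: filter_forall => i; exists (Num.trunc (tnth z.1 i)).+1 => // k /= ik.
  by apply: (lt_le_trans (truncnS_gt _)); rewrite ler_nat.
by move=> [k _ /(_ k (leqnn k))]; exists k.
Qed.

Let measurable_realP d (U : measurableType d) (h : U -> R) :
  (forall r, measurable [set x | h x < r]) -> measurable_fun setT h.
Proof.
move=> H; apply: (measurability _ (RGenInftyO.measurableE R)) => //.
move=> _ [_ [r ->] <-]; rewrite setTI.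
by rewrite (_ : h @^-1` `]-oo, r[%classic = [set x | h x < r]).
Qed.

(** For the nontrivial inclusion, each coordinate is measurable for the sigma-algebra generated by
    [G], because a half-space is a countable union of orthants whose other faces recede to infinity.
    Hence the identity from [X'] to [X] is measurable. *)
Let G_gen : (measurable : set (set X)) = <<s G >>.
Proof.
apply/seteqP; split; last first.
  apply: smallest_sub; first exact: sigma_algebra_measurable.
  by move=> _ [a [T ->]]; exact: measurable_orthant.
pose X' := g_sigma_algebraType G.
have mX' (A : set X) : G A -> measurable (A : set X') by exact: sub_sigma_algebra.
have m1 (i : 'I_n) : measurable_fun [set: X'] (fun z : X' => tnth (z : X).1 i).
  apply: measurable_realP => r.
  rewrite (_ : [set x | _] = \bigcup_k
     (orthant (fun j => if j == i then r else k%:R) k%:R : set X')).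
    by apply: bigcupT_measurable => k; apply: mX'; eexists; eexists.
  apply/seteqP; split => [z /= zr|z [k _ [/(_ i)]]]; last by rewrite eqxx.
  have [k1 zk1] := coord_ub z; have := truncnS_gt z.2; set k2 := (_.+1)%N => zk2.
  exists (maxn k1 k2) => //; split.
    move=> j; case: eqP => [->//|_]; apply: (lt_le_trans (zk1 j)).
    by rewrite ler_nat leq_maxl.
  by apply: (lt_le_trans zk2); rewrite ler_nat leq_maxr.
have m2 : measurable_fun [set: X'] (fun z : X' => (z : X).2).
  apply: measurable_realP => r.
  rewrite (_ : [set x | _] = \bigcup_k (orthant (fun j => k%:R) r : set X')).
    by apply: bigcupT_measurable => k; apply: mX'; eexists; eexists.
  apply/seteqP; split => [z /= zr|z [k _ []]]//.
  by have [k zk] := coord_ub z; exists k.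
have mid : measurable_fun [set: X'] (fun z : X' => (z : X)).
  apply/measurable_fun_pairP; split => //.
  by apply/measurable_fun_tnthP => i; exact: m1.
move=> A mA; have := mid measurableT A mA; rewrite setTI preimage_id; exact.
Qed.

(** Orthants form a generating pi-system, exhausted by orthants of finite f1-mass, so the two
    densities define the same measure. Almost everywhere equality then follows on each [past n k],
    where f1 is integrable. *)
Lemma orthant_unique (f1 f2 : X -> R) :
  measurable_fun setT f1 -> measurable_fun setT f2 ->
  (forall z, 0 <= f1 z) -> (forall z, 0 <= f2 z) ->
  (forall T : R, (\int[nu]_(z in past n T) (f1 z)%:E < +oo)%E) ->
  (forall a T, \int[nu]_(z in orthant a T) (f1 z)%:E =
               \int[nu]_(z in orthant a T) (f2 z)%:E)%E ->
  {ae nu, forall z, f1 z = f2 z}.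
Proof.
move=> mf1 mf2 f10 f20 f1oo f12.
pose m1 := density_measure nu f1 mf1 f10.
pose m2 := density_measure nu f2 mf2 f20.
pose g (k : nat) : set X := orthant (fun=> k%:R) k%:R.
have Gg k : G (g k) by eexists; eexists.
have gT : \bigcup_k g k = setT.
  rewrite -subTset => z _.
  have [k1 zk1] := coord_ub z; have := truncnS_gt z.2; set k2 := (_.+1)%N => zk2.
  exists (maxn k1 k2) => //; split.
    by move=> j; apply: (lt_le_trans (zk1 j)); rewrite ler_nat leq_maxl.
  by apply: (lt_le_trans zk2); rewrite ler_nat leq_maxr.
have m12G A : G A -> m1 A = m2 A by move=> [a [T ->]]; exact: f12.
have m1g k : (m1 (g k) < +oo)%E.
  apply: le_lt_trans (f1oo k%:R); apply: ge0_subset_integral => //.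
  - exact: measurable_orthant.
  - exact: measurable_past.
  - by apply: measurable_funTS; exact/measurable_EFinP.
  - by move=> z _; rewrite lee_fin.
  - by move=> z [].
have m12 := @measure_unique _ R (n.-tuple R * measurableTypeR R)%type G g
  G_gen G_setI Gg gT m1 m2 m12G m1g.
have aek (k : nat) : {ae nu, forall z, past n (k%:R : R) z -> f1 z = f2 z}.
  have : ae_eq nu (past n (k%:R : R)) (fun z => (f1 z)%:E) (fun z => (f2 z)%:E).
    apply: integral_ae_eq.
    - exact: measurable_past.
    - apply/integrableP; split.
        by apply: measurable_funTS; exact/measurable_EFinP.
      apply: le_lt_trans (f1oo k%:R); rewrite le_eqVlt; apply/orP; left; apply/eqP.
      by apply: eq_integral => z _; rewrite gee0_abs// lee_fin.
    - by apply: measurable_funTS; exact/measurable_EFinP.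
    - by move=> E _ mE; exact: m12.
  by apply: filterS => z /[apply] -[].
have : \forall z \ae nu, forall k : nat, past n (k%:R : R) z -> f1 z = f2 z.
  exact: ae_foralln.
apply: filterS => z /(_ (Num.trunc z.2).+1); apply; exact: truncnS_gt.
Qed.

Lemma lebesgue_tuple_hyperplane k (i : 'I_k) (r : R) :
  lebesgue_tuple k [set x : k.-tuple R | tnth x i = r] = 0%E.
Proof.
elim: k i => [|k IH] i; first by case: i.
have mh : measurable [set x : k.+1.-tuple R | tnth x i = r].
  have := @measurable_tnth _ R k.+1 i measurableT [set r] (measurable_set1 r).
  by rewrite setTI.
rewrite [LHS](_ : _ = (mu \x @lebesgue_tuple R k)%E
   (@tuple_cons R k @^-1` [set x : k.+1.-tuple R | tnth x i = r]))//.
have [j ->|->] := unliftP ord0 i.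
  rewrite (_ : _ @^-1` _ = setT `*` [set x : k.-tuple R | tnth x j = r]).
    rewrite product_measure1E ?IH ?mule0//.
    have := @measurable_tnth _ R k j measurableT [set r] (measurable_set1 r).
    by rewrite setTI.
  by apply/seteqP; split => -[b x] /=; rewrite /tuple_cons/= tnthS//; case.
rewrite (_ : _ @^-1` _ = [set r] `*` setT).
  by rewrite product_measure1E// [X in (X * _)%E](lebesgue_measure_set1 r) mul0e.
by apply/seteqP; split => -[b x] /=; rewrite /tuple_cons/= tnth0//; case.
Qed.

(** Away from these hyperplanes the indicator of an orthant is locally constant, which is what
    [mollify_cvg] asks for. *)
Lemma ae_off_orthant_boundary a T :
  {ae nu, forall z, (forall i, tnth z.1 i != a i) /\ z.2 != T}.
Proof.
have A1 : {ae nu, forall z, forall i, tnth z.1 i != a i}.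
  apply: filter_forall => i.
  exists ([set x : n.-tuple R | tnth x i = a i] `*` setT); split.
  - apply: measurableX => //.
    have := @measurable_tnth _ R n i measurableT [set a i] (measurable_set1 (a i)).
    by rewrite setTI.
  - rewrite [LHS]product_measure1E//; last first.
      have := @measurable_tnth _ R n i measurableT [set a i] (measurable_set1 (a i)).
      by rewrite setTI.
    by rewrite [X in (X * _)%E]lebesgue_tuple_hyperplane mul0e.
  - by move=> z /= /negP; rewrite negbK => /eqP.
have A2 : {ae nu, forall z : X, z.2 != T}.
  exists (setT `*` [set T]); split.
  - by apply: measurableX => //; exact: measurable_set1.
  - by rewrite [LHS]product_measure1E// [X in (_ * X)%E](lebesgue_measure_set1 T) mule0.
  - by move=> z /= /negP; rewrite negbK => /eqP.
by apply: filterS2 A1 A2.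
Qed.

End orthants.

(** * A space-time approximate identity *)

Section approximate_identity.
Context {R : realType} {n : nat}.
Local Notation mu := (@lebesgue_measure R).
Local Notation X := (n.-tuple R * R)%type.
Local Notation nu := (@lebesgue_spacetime R n).
Implicit Types (eta r : R) (z w : X).

(** The indicator of ]eta, 2 eta], in a form that turns integrals against it into differences of
    moments of order 0. The gap below eta keeps both end times strictly before the Gaussian's
    singular time. *)
Definition win eta r : R := pw 0 (r - eta) - pw 0 (r - 2 * eta).

Lemma winE eta r : 0 < eta -> win eta r = ((eta < r <= 2 * eta)%R : nat)%:R.
Proof.
move=> e0; rewrite /win; have [er|re] := ltP eta r; last first.
  by rewrite !pw_neg ?subr0//; lra.
have [re|er2] := leP r (2 * eta).
  by rewrite pw_pos ?powRr0 ?subr_gt0// pw_neg ?subr0//; lra.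
by rewrite !pw_pos ?powRr0 ?subrr ?subr_gt0.
Qed.

Lemma win_ge0 eta r : 0 < eta -> 0 <= win eta r.
Proof. by move=> e0; rewrite winE. Qed.

Lemma measurable_win d (U : measurableType d) eta (h : U -> R) :
  measurable_fun setT h -> measurable_fun setT (fun u => win eta (h u)).
Proof.
by move=> mh; apply: measurable_funB; apply: measurable_pw; exact: measurable_funB.
Qed.

Lemma integral_win eta t : 0 < eta -> (\int[mu]_s (win eta (s - t))%:E = eta%:E)%E.
Proof.
move=> e0; transitivity (\int[mu]_s (\1_(`]t + eta, t + 2 * eta]%classic : set R) s)%:E)%E.
  apply: eq_integral => s _; rewrite winE// indicE; congr (_%:R)%:E.
  congr (nat_of_bool _); apply/idP/idP.
    by move=> /andP[a b]; rewrite mem_set//= in_itv/=; apply/andP; split; lra.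
  by move=> /set_mem/=; rewrite in_itv/= => /andP[a b]; apply/andP; split; lra.
rewrite integral_indic//= setIT lebesgue_measure_itv/= lte_fin.
by rewrite ltrD2l ltr_pMl// ltr1n -EFinD; congr EFin; ring.
Qed.

(** For c = 1 and a fixed pole [w], this is a time window times the backward Gaussian ending at [w].
    The value c = 2 serves only as a comparison kernel for tails. *)
Definition kern (c eta : R) w z : R :=
  win eta (w.2 - z.2) * gauss (c * (w.2 - z.2)) (tuple_sub z.1 w.1).

Lemma kern_ge0 c eta w z : 0 < eta -> 0 <= kern c eta w z.
Proof. by move=> e0; rewrite mulr_ge0 ?win_ge0 ?gauss_ge0. Qed.

Lemma measurable_kern d (U : measurableType d) c eta (w z : U -> X) :
  measurable_fun setT w -> measurable_fun setT z ->
  measurable_fun setT (fun u => kern c eta (w u) (z u)).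
Proof.
move=> mw mz.
have mw1 : measurable_fun setT (fun u => (w u).1) by exact: measurableT_comp.
have mw2 : measurable_fun setT (fun u => (w u).2) by exact: measurableT_comp.
have mz1 : measurable_fun setT (fun u => (z u).1) by exact: measurableT_comp.
have mz2 : measurable_fun setT (fun u => (z u).2) by exact: measurableT_comp.
apply: measurable_funM; first by apply: measurable_win; exact: measurable_funB.
apply: measurable_gauss; last exact: measurable_tuple_sub.
by apply: measurable_funM => //; exact: measurable_funB.
Qed.

Lemma integral_kern c eta z : 0 < c -> 0 < eta ->
  (\int[nu]_w (kern c eta w z)%:E = eta%:E)%E.
Proof.
move=> c0 e0; rewrite ge0_integral_spacetime; last 2 first.
- by apply/measurable_EFinP; exact: measurable_kern.
- by move=> w; rewrite lee_fin kern_ge0.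
rewrite -(integral_win eta z.2)//; apply: eq_integral => t _; rewrite /kern/=.
have [et|te] := ltP 0 (win eta (t - z.2)); last first.
  have -> : win eta (t - z.2) = 0 by apply/eqP; rewrite eq_le te win_ge0.
  by apply: integral0_eq => x _; rewrite mul0r.
have tz : 0 < t - z.2.
  by move: et; rewrite winE//; case: (boolP (_ && _)) => [/andP[? _] _|_]; [lra|rewrite ltxx].
under eq_integral do rewrite EFinM gaussC.
rewrite ge0_integralZl//; last 3 first.
- apply/measurable_EFinP; apply: measurable_gauss => //.
  exact: measurable_tuple_sub.
- by move=> x _; rewrite lee_fin gauss_ge0.
- by rewrite lee_fin win_ge0.
by rewrite integral_gauss ?mule1// mulr_gt0.
Qed.

(** The factor 2^(n/2) * 8 r / delta of [gauss_far], with r <= 2 eta from the window. *)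
Definition kern_const : R := 16 * 2 `^ (n%:R / 2).

(** Half of the exponent is kept as a Gaussian of doubled time, with normalisations differing by
    2^(n/2); the other half is bounded by exp(-s) <= 1/s at s = |x|^2 / (8 r). *)
Lemma gauss_far (delta r : R) (x : n.-tuple R) : 0 < r -> 0 < delta ->
  delta <= sqr_norm x ->
  gauss r x <= 2 `^ (n%:R / 2) * (8 * r / delta) * gauss (2 * r) x.
Proof.
move=> r0 d0 dx; rewrite /gauss.
have P0 : 0 < 4 * pi * r by rewrite !mulr_gt0// pi_gt0.
rewrite (_ : 4 * pi * (2 * r) = 2 * (4 * pi * r)); last by ring.
rewrite [in leRHS]powRM ?(ltW P0)//.
rewrite (_ : - (sqr_norm x / (4 * r)) =
  - (sqr_norm x / (8 * r)) + - (sqr_norm x / (4 * (2 * r)))); last first.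
  by field; rewrite gt_eqF.
rewrite expRD.
set P := (4 * pi * r) `^ _; set Q := 2 `^ _; set A := expR _; set B := expR _.
have PP : 0 < P by rewrite powR_gt0.
have QQ : 0 < Q by rewrite powR_gt0.
have B0 : 0 < B by exact: expR_gt0.
rewrite (_ : Q * (8 * r / delta) * ((Q * P)^-1 * B) = P^-1 * ((8 * r / delta) * B));
  last by field; rewrite !gt_eqF.
rewrite ler_wpM2l ?invr_ge0 ?(ltW PP)// ler_wpM2r ?(ltW B0)//.
rewrite /A expRN -[leRHS]invrK lef_pV2 ?posrE ?expR_gt0 ?invr_gt0 ?divr_gt0 ?mulr_gt0//.
apply: (@le_trans _ _ (sqr_norm x / (8 * r))).
  by rewrite invf_div ler_pM2r// invr_gt0 mulr_gt0.
by apply: le_trans (expR_ge1Dx _); rewrite lerDr.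
Qed.

(** The window limits the time lag to 2 eta < delta, so wherever the kernel is nonzero on [A] the
    points are far in space. There [gauss_far] compares it with the kernel for c = 2, whose total
    integral is eta. *)
Lemma kern_far (A : set X) eta delta z : measurable A -> 0 < eta -> 2 * eta < delta ->
  (forall w, A w -> delta <= sqr_norm (tuple_sub z.1 w.1) \/ delta <= `|w.2 - z.2|) ->
  (\int[nu]_(w in A) (kern 1 eta w z)%:E <= (kern_const * (eta / delta) * eta)%:E)%E.
Proof.
move=> mA e0 ed Afar; have d0 : 0 < delta by lra.
have K0 : 0 <= kern_const * (eta / delta).
  by rewrite mulr_ge0 ?divr_ge0 ?ltW// mulr_gt0 ?powR_gt0.
rewrite EFinM -(integral_kern 2 eta z)// -ge0_integralZl//; last 2 first.
- by apply/measurable_EFinP; exact: measurable_kern.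
- by move=> w _; rewrite lee_fin kern_ge0.
rewrite [leLHS]integral_mkcond; apply: ge0_le_integral => //.
- by move=> w _; apply: erestrict_ge0 => v _; rewrite lee_fin kern_ge0.
- apply/(measurable_restrictT _ mA); apply: measurable_funTS; apply/measurable_EFinP.
  exact: measurable_kern.
- by apply: measurable_funeM; apply/measurable_EFinP; exact: measurable_kern.
- move=> w _; rewrite patchE -EFinM; case: ifPn => [/set_mem Aw|_]; last first.
    by rewrite lee_fin mulr_ge0// kern_ge0.
  rewrite lee_fin /kern mul1r winE//.
  case: (boolP (_ && _)) => [/andP[r1 r2]|_]; last by rewrite /= !mul0r mulr0.
  rewrite /= !mul1r; set r := w.2 - z.2 in r1 r2 *.
  have r0 : 0 < r by lra.
  have far : delta <= sqr_norm (tuple_sub z.1 w.1).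
    have [//|] := Afar w Aw; rewrite -/r gtr0_norm//; lra.
  apply: (le_trans (gauss_far _ _ _ r0 d0 far)); rewrite ler_wpM2r ?gauss_ge0//.
  rewrite /kern_const (mulrC 16) -[leRHS]mulrA ler_wpM2l ?powR_ge0//.
  rewrite mulrA ler_pM2r ?invr_gt0//; lra.
Qed.

(** The integration runs over the pole [w]: this is the transposed mollification, obtained when
    Tonelli shifts the kernel from [f] to the indicator of [B]. *)
Definition mollify (B : set X) eta z : R :=
  fine (\int[nu]_(w in B) (kern 1 eta w z)%:E)%E / eta.

Section fixed_set.
Variables (B : set X) (mB : measurable B).

Lemma integral_kern_le eta z : 0 < eta ->
  (\int[nu]_(w in B) (kern 1 eta w z)%:E <= eta%:E)%E.
Proof.
move=> e0; rewrite -(integral_kern 1 eta z)//; apply: ge0_subset_integral => //.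
- by apply/measurable_EFinP; exact: measurable_kern.
- by move=> w _; rewrite lee_fin kern_ge0.
Qed.

Lemma integral_kern_ge0 eta z : 0 < eta ->
  (0 <= \int[nu]_(w in B) (kern 1 eta w z)%:E)%E.
Proof. by move=> e0; apply: integral_ge0 => w _; rewrite lee_fin kern_ge0. Qed.

Lemma mollifyE eta z : 0 < eta ->
  (\int[nu]_(w in B) (kern 1 eta w z)%:E = (eta * mollify B eta z)%:E)%E.
Proof.
move=> e0; rewrite /mollify mulrC divfK ?gt_eqF// fineK//.
rewrite ge0_fin_numE ?integral_kern_ge0//.
by apply: le_lt_trans (integral_kern_le eta z e0) _; rewrite ltry.
Qed.

Lemma mollify_ge0 eta z : 0 < eta -> 0 <= mollify B eta z.
Proof.
move=> e0; rewrite divr_ge0 ?(ltW e0)// fine_ge0//; exact: integral_kern_ge0.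
Qed.

Lemma mollify_le1 eta z : 0 < eta -> mollify B eta z <= 1.
Proof.
move=> e0; have := integral_kern_le eta z e0; rewrite mollifyE// lee_fin.
by rewrite -[leRHS]mulr1 ler_pM2l.
Qed.

Lemma mollify_past eta z T : 0 < eta -> B `<=` past n T -> T <= z.2 ->
  mollify B eta z = 0.
Proof.
move=> e0 BT Tz; rewrite /mollify integral0_eq ?mul0r// => w /BT; rewrite /past/= => wT.
by rewrite /kern winE// (_ : (_ && _) = false) ?mul0r//; apply/negP => /andP[]; lra.
Qed.

Lemma measurable_mollify eta : 0 < eta ->
  measurable_fun setT (fun z => (mollify B eta z)%:E).
Proof.
move=> e0.
pose H (q : X * X) : \bar R := (kern 1 eta q.2 q.1 * \1_B q.2)%:E.
have mH : measurable_fun setT (fubini_F nu H).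
  apply: measurable_fun_fubini_tonelli_F.
    apply/measurable_EFinP; apply: measurable_funM; first exact: measurable_kern.
    by apply: measurableT_comp => //; exact: measurable_indic.
  by move=> q; rewrite lee_fin mulr_ge0 ?kern_ge0// indicE ler0n.
rewrite (_ : (fun z => _) = (fun z => (eta^-1)%:E * fubini_F nu H z)%E).
  exact: measurable_funeM.
apply/funext => z; rewrite /fubini_F /H/=.
rewrite (_ : mollify B eta z = eta^-1 * (eta * mollify B eta z)); last first.
  by rewrite mulrA mulVf ?mul1r// gt_eqF.
rewrite EFinM -mollifyE// integral_mkcond; congr (_ * _)%E.
apply: eq_integral => w _; rewrite patchE indicE.
by case: ifPn => wB; rewrite ?mulr1 ?mulr0.
Qed.

(** The error is the normalised kernel mass of the points whose membership in [B] differs from that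
    of [z]. They are all far from [z], so [kern_far] makes it O(eta / delta). *)
Lemma mollify_cvg z delta : 0 < delta ->
  (forall w, sqr_norm (tuple_sub z.1 w.1) < delta -> `|w.2 - z.2| < delta ->
    B w <-> B z) ->
  mollify B k.+1%:R^-1 z @[k --> \oo] --> (\1_B z : R).
Proof.
move=> d0 Bz.
have C0 : 0 < kern_const by rewrite mulr_gt0 ?powR_gt0.
have far (A : set X) eta : measurable A -> 0 < eta -> 2 * eta < delta ->
    (forall w, A w -> ~ (B w <-> B z)) ->
    (\int[nu]_(w in A) (kern 1 eta w z)%:E <= (kern_const * (eta / delta) * eta)%:E)%E.
  move=> mA e0 ed AB; apply: kern_far => // w Aw.
  have [|h1] := leP delta (sqr_norm (tuple_sub z.1 w.1)); first by left.
  have [|h2] := leP delta `|w.2 - z.2|; first by right.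
  by exfalso; apply: (AB w Aw); exact: Bz.
have est eta : 0 < eta -> 2 * eta < delta ->
    `|\1_B z - mollify B eta z| <= kern_const / delta * eta.
  move=> e0 ed; have [zB|zB] := pselect (B z).
    rewrite indicE mem_set// ger0_norm ?subr_ge0 ?mollify_le1//.
    have mBC := measurableC mB.
    have := far _ eta mBC e0 ed => /(_ _) h.
    have {}h : (\int[nu]_(w in ~` B) (kern 1 eta w z)%:E <=
        (kern_const * (eta / delta) * eta)%:E)%E.
      by apply: h => w /= wB [_ /(_ zB)].
    have : (\int[nu]_(w in B) (kern 1 eta w z)%:E + \int[nu]_(w in ~` B) (kern 1 eta w z)%:E
        = eta%:E)%E.
      rewrite -(integral_kern 1 eta z)// -(setUv B) ge0_integral_setU//.
      - by rewrite setUv; apply/measurable_EFinP; exact: measurable_kern.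
      - by move=> w _; rewrite lee_fin kern_ge0.
      - by apply/disj_setPS; rewrite setICr.
    rewrite mollifyE// => e1.
    have : (eta%:E <= (eta * mollify B eta z)%:E + (kern_const * (eta / delta) * eta)%:E)%E.
      by rewrite -[leLHS]e1 leeD2l.
    rewrite -EFinD lee_fin => e2; rewrite lerBlDl -(ler_pM2l e0) mulr1 (le_trans e2)//.
    by rewrite le_eqVlt; apply/orP; left; apply/eqP; ring.
  rewrite indicE memNset// sub0r normrN ger0_norm ?mollify_ge0//.
  have := far B eta mB e0 ed => /(_ _) h.
  have {}h : (\int[nu]_(w in B) (kern 1 eta w z)%:E <=
      (kern_const * (eta / delta) * eta)%:E)%E.
    by apply: h => w /= wB [/(_ wB)].
  move: h; rewrite mollifyE// lee_fin -(ler_pM2l e0) => h.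
  rewrite -(ler_pM2l e0); apply: (le_trans (y := kern_const * (eta / delta) * eta)).
    by move: h; rewrite ler_pM2l.
  by rewrite le_eqVlt; apply/orP; left; apply/eqP; ring.
apply/cvgrPdist_le => e e0; near=> k.
have k0 : 0 < k.+1%:R^-1 :> R by rewrite invr_gt0.
apply: (le_trans (est _ k0 _)).
  rewrite mulrC -ltr_pdivlMr//; near: k.
  exact: (near_infty_natSinv_lt (PosNum (divr_gt0 d0 (ltr0Sn R 1)))).
rewrite mulrC -ler_pdivlMr ?divr_gt0// ltW//; near: k.
exact: (near_infty_natSinv_lt (PosNum (divr_gt0 e0 (divr_gt0 C0 d0)))).
Unshelve. all: by end_near. Qed.

End fixed_set.

Lemma orthant_locally_constant a T z : (forall i, tnth z.1 i != a i) -> z.2 != T ->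
  exists2 delta : R, 0 < delta & forall w : X,
    sqr_norm (tuple_sub z.1 w.1) < delta -> `|w.2 - z.2| < delta ->
    orthant a T w <-> orthant a T z.
Proof.
move=> za zT.
have zT0 : 0 < `|z.2 - T| by rewrite normr_gt0 subr_eq0.
have n1 : \forall k \near \oo, forall i : 'I_n, k.+1%:R^-1 < (tnth z.1 i - a i) ^+ 2.
  apply: filter_forall => i.
  have zi : 0 < (tnth z.1 i - a i) ^+ 2 by rewrite exprn_even_gt0//= subr_eq0.
  exact: (near_infty_natSinv_lt (PosNum zi)).
have n2 : \forall k \near \oo, k.+1%:R^-1 < `|z.2 - T|.
  exact: (near_infty_natSinv_lt (PosNum zT0)).
have [k _ /(_ k (leqnn k)) [kz kT]] := filterI n1 n2.
exists k.+1%:R^-1; first by rewrite invr_gt0.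
move=> w w1 w2.
have iffi i : (tnth w.1 i < a i) = (tnth z.1 i < a i).
  have : (tnth z.1 i - tnth w.1 i) ^+ 2 < (tnth z.1 i - a i) ^+ 2.
    apply: le_lt_trans (lt_trans w1 (kz i)).
    rewrite /sqr_norm (bigD1 i)//= tnth_mktuple lerDl.
    by apply: sumr_ge0 => j _; exact: sqr_ge0.
  (* Points on different sides of [a i] would satisfy |z_i - w_i| >= |z_i - a_i|. *)
  by move=> h; apply/idP/idP => ?; rewrite ltNge; apply/negP => ?; nra.
have iffT : (w.2 < T) = (z.2 < T).
  have h := lt_trans w2 kT; case: (ltrgtP z.2 T) h => [zT1|zT1|zT1] h.
  - by move: h; rewrite ltr_norml => /andP[h1 h2]; lra.
  - move: h; rewrite ltr_norml => /andP[h1 h2].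
    by apply/negbTE; rewrite -leNgt; lra.
  - by move: zT; rewrite zT1 eqxx.
by split => -[h1 h2]; split; [move=> i; rewrite -iffi|rewrite -iffT|
  move=> i; rewrite iffi|rewrite iffT].
Qed.

(** Integrals of f against mollified indicators of orthants are averages of the given kernel
    integrals, hence agree; then eta -> 0. *)
Lemma kern_unique (f1 f2 : X -> R) :
  measurable_fun setT f1 -> measurable_fun setT f2 ->
  (forall z, 0 <= f1 z) -> (forall z, 0 <= f2 z) ->
  (forall T : R, (\int[nu]_(z in past n T) (f1 z)%:E < +oo)%E) ->
  (forall T : R, (\int[nu]_(z in past n T) (f2 z)%:E < +oo)%E) ->
  (forall eta w, 0 < eta -> (\int[nu]_z (f1 z * kern 1 eta w z)%:E =
                             \int[nu]_z (f2 z * kern 1 eta w z)%:E)%E) ->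
  {ae nu, forall z, f1 z = f2 z}.
Proof.
move=> mf1 mf2 f10 f20 foo1 foo2 H; apply: orthant_unique => // a T.
have mB := measurable_orthant a T; set B := orthant a T in mB *.
have BT : B `<=` past n T by move=> z [].
have kE k : 0 < k.+1%:R^-1 :> R by rewrite invr_gt0.
have eqk (f : X -> R) eta : measurable_fun setT f -> (forall z, 0 <= f z) -> 0 < eta ->
    (\int[nu]_z (f z * mollify B eta z)%:E =
     eta^-1%:E * \int[nu]_(w in B) \int[nu]_z (f z * kern 1 eta w z)%:E)%E.
  move=> mf f0 e0.
  pose K (q : X * X) : \bar R := (f q.1 * (kern 1 eta q.2 q.1 * \1_B q.2))%:E.
  have mK : measurable_fun setT K.
    apply/measurable_EFinP; apply: measurable_funM; first exact: measurableT_comp.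
    apply: measurable_funM; first exact: measurable_kern.
    by apply: measurableT_comp => //; exact: measurable_indic.
  have K0 q : (0 <= K q)%E.
    by rewrite lee_fin mulr_ge0// mulr_ge0 ?kern_ge0// indicE ler0n.
  have e1 : (\int[nu]_(w in B) \int[nu]_z (f z * kern 1 eta w z)%:E =
      \int[nu]_w \int[nu]_z K (z, w))%E.
    rewrite integral_mkcond; apply: eq_integral => w _; rewrite patchE /K/= indicE.
    case: ifPn => wB; first by apply: eq_integral => z _; rewrite mulr1.
    by apply/esym; apply: integral0_eq => z _; rewrite !mulr0.
  rewrite e1 -(@fubini_tonelli _ _ _ _ _ nu nu K)// -ge0_integralZl//; last 3 first.
  - exact: measurable_fun_fubini_tonelli_F.
  - by move=> z _; apply: integral_ge0.
  - by rewrite lee_fin invr_ge0 ltW.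
  apply: eq_integral => z _.
  rewrite (_ : f z * mollify B eta z = eta^-1 * (f z * (eta * mollify B eta z)));
    last by field; rewrite gt_eqF.
  rewrite EFinM; congr (_ * _)%E; rewrite EFinM -mollifyE// integral_mkcond.
  rewrite -ge0_integralZl//; last 3 first.
  - apply/(measurable_restrictT _ mB); apply: measurable_funTS; apply/measurable_EFinP.
    exact: measurable_kern.
  - by move=> w _; apply: erestrict_ge0 => v _; rewrite lee_fin kern_ge0.
  - by rewrite lee_fin.
  apply: eq_integral => w _; rewrite patchE /K/= indicE.
  by case: ifPn => wB; rewrite ?mulr1 ?mulr0 ?mule0// EFinM.
have cv (f : X -> R) : measurable_fun setT f -> (forall z, 0 <= f z) ->
    (forall T : R, (\int[nu]_(z in past n T) (f z)%:E < +oo)%E) ->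
    (\int[nu]_z (f z * mollify B k.+1%:R^-1 z)%:E @[k --> \oo] -->
     \int[nu]_(z in B) (f z)%:E)%E.
  move=> mf f0 foo.
  have -> : (\int[nu]_(z in B) (f z)%:E = \int[nu]_z (f z * \1_B z)%:E)%E.
    rewrite integral_mkcond; apply: eq_integral => z _; rewrite patchE indicE.
    by case: ifPn => zB; rewrite ?mulr1 ?mulr0.
  (* Only integrability over pasts is available; [mollify_past] provides a dominating function
     supported in one of them. *)
  pose dom := ((fun z => (f z)%:E) \_ (past n T)).
  have mpT := measurable_past (n := n) T.
  have := @dominated_convergence _ _ _ nu setT measurableT
    (fun k z => (f z * mollify B k.+1%:R^-1 z)%:E) (fun z => (f z * \1_B z)%:E) dom.
  case=> //.
  - move=> k; apply/measurable_EFinP; apply: measurable_funM => //.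
    apply/measurable_EFinP; exact: measurable_mollify.
  - apply/measurable_EFinP; apply: measurable_funM => //; exact: measurable_indic.
  - apply: filterS (ae_off_orthant_boundary a T) => z [za zT] _.
    have [delta d0 dz] := orthant_locally_constant a T z za zT.
    apply: cvg_EFin; first exact: nearW.
    rewrite (_ : fine \o _ = fun k => f z * mollify B k.+1%:R^-1 z)//.
    by apply: cvgMr; exact: (mollify_cvg _ mB z delta d0 dz).
  - apply/integrableP; split.
      apply/(measurable_restrictT _ mpT); apply: measurable_funTS.
      exact/measurable_EFinP.
    have -> : (\int[nu]_z `|dom z| = \int[nu]_(z in past n T) (f z)%:E)%E; last exact: foo.
    rewrite [RHS]integral_mkcond; apply: eq_integral => z _; rewrite gee0_abs//.
    by apply: erestrict_ge0 => w _; rewrite lee_fin.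
  - apply: aeW => z k _; rewrite gee0_abs; last first.
      by rewrite lee_fin mulr_ge0 ?mollify_ge0.
    rewrite /dom patchE; case: ifPn => [_|].
      by rewrite lee_fin ler_piMr ?mollify_le1.
    rewrite notin_setE => /negP; rewrite -leNgt => Tz.
    by rewrite (mollify_past B _ z T)// mulr0.
have c1 := cv f1 mf1 f10 foo1; have c2 := cv f2 mf2 f20 foo2.
rewrite -(cvg_lim _ c1)// -(cvg_lim _ c2)//; congr (limn _); apply/funext => k.
rewrite !eqk//; congr (_ * _)%E; apply: eq_integral => w _; exact: H.
Qed.

End approximate_identity.

(** * Injectivity of J on nonnegative functions *)

Section injectivity.
Context {R : realType} {n : nat}.
Local Notation mu := (@lebesgue_measure R).
Local Notation X := (n.-tuple R * R)%type.
Local Notation nu := (@lebesgue_spacetime R n).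

Lemma J_ae_eq (a : R) (f g : X -> R) (z : X) :
  measurable_fun setT f -> measurable_fun setT g ->
  {ae nu, forall w, f w = g w} -> J a f z = J a g z.
Proof.
move=> mf mg fg; rewrite !J_fheat; apply: ae_eq_integral => //.
- apply/measurable_EFinP; apply: measurable_funM => //; apply: measurable_funM => //.
  exact: measurable_fheat.
- apply/measurable_EFinP; apply: measurable_funM => //; apply: measurable_funM => //.
  exact: measurable_fheat.
- by apply: filterS fg => w fw _; rewrite fw.
Qed.

Lemma J_add (a : R) (f g : X -> R) (z : X) : 0 < a ->
  measurable_fun setT f -> measurable_fun setT g ->
  (forall w, 0 <= f w) -> (forall w, 0 <= g w) ->
  (J a (f \+ g)%R z = J a f z + J a g z)%E.
Proof.
move=> a0 mf mg f0 g0; rewrite !J_fheat.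
have G0 : 0 <= (Gamma a)^-1 by rewrite invr_ge0 ltW// Gamma_gt0.
have mK (h : X -> R) : measurable_fun setT h ->
    measurable_fun setT (fun w => ((Gamma a)^-1 * (fheat (a - 1) w z * h w))%:E).
  move=> mh; apply/measurable_EFinP; apply: measurable_funM => //.
  by apply: measurable_funM => //; exact: measurable_fheat.
rewrite -ge0_integralD//.
- by apply: eq_integral => w _; rewrite -EFinD -mulrDr -mulrDr.
- by move=> w _; rewrite lee_fin mulr_ge0// mulr_ge0// fheat_ge0.
- exact: mK.
- by move=> w _; rewrite lee_fin mulr_ge0// mulr_ge0// fheat_ge0.
- exact: mK.
Qed.

(** The exponent r = k + b must exceed alpha - 1 so that r - alpha is admissible for the adjoint,
    must not exceed n/2 so that moments are finite, and must not be an integer, as the fractional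
    step needs 0 < b < 1. *)
Lemma fractional_exponent (alpha : R) : (1 <= n)%N -> alpha < n%:R / 2 + 1 ->
  exists k (b : R), [/\ 0 < b < 1, alpha - 1 < k%:R + b & k%:R + b <= n%:R / 2].
Proof.
move=> n1 an; have nE : n%:R = (odd n)%:R + 2 * (n./2)%:R :> R.
  by rewrite -[in LHS](odd_double_half n) natrD -mul2n natrM.
case: (boolP (odd n)) nE => [on|en] nE.
  (* For odd n, r = n/2 itself is not an integer. For even n, k = n/2 - 1 and b is 1/2 or, if alpha
     - 1 >= k, the midpoint of alpha - 1 - k and 1. *)
  rewrite /= in nE; exists n./2, 2^-1.
  by split; [apply/andP; split; lra|lra|lra].
rewrite /= in nE; have h1 : (0 < n./2)%N.
  by rewrite half_gt0; case: (n) n1 en => [|[|]].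
have kE : n./2%:R = n./2.-1%:R + 1 :> R by rewrite natr1 prednK.
exists n./2.-1; set k : R := n./2.-1%:R in kE *.
have [x0|x0] := leP 0 (alpha - 1 - k).
  exists ((1 + (alpha - 1 - k)) / 2).
  by split; [apply/andP; split; lra|lra|lra].
by exists 2^-1; split; [apply/andP; split; lra|lra|lra].
Qed.

Definition gweight (f : X -> R) (S : R) (y : n.-tuple R) (z : X) : R :=
  f z * gauss (S - z.2) (tuple_sub z.1 y).

Lemma measurable_gweight f S y : measurable_fun setT f ->
  measurable_fun setT (gweight f S y).
Proof.
move=> mf; apply: measurable_funM => //; apply: measurable_gauss.
  exact: measurable_funB.
exact: measurable_tuple_sub.
Qed.

(** In the distant past the weight is at most a constant times (S - t)^(q - n/2), which for q <= n/2
    is largest at t = T; this gives [C]. *)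
Lemma moment_gweight_lty (f : X -> R) (S : R) (y : n.-tuple R) (q T : R) : measurable_fun setT f -> (forall z, 0 <= f z) ->
  (\int[nu]_(z in past n T) (f z)%:E < +oo)%E ->
  0 <= q <= n%:R / 2 -> T < S -> (moment nu snd (gweight f S y) q T < +oo)%E.
Proof.
move=> mf f0 foo /andP[q0 qn] TS.
pose C : R := ((4 * pi) `^ (n%:R / 2))^-1 * (S - T) `^ (q - n%:R / 2).
have C0 : 0 <= C by rewrite mulr_ge0 ?invr_ge0 ?powR_ge0.
have mT := measurable_past (n := n) T.
apply: (@le_lt_trans _ _ (C%:E * \int[nu]_(z in past n T) (f z)%:E)%E); last first.
  by apply: lte_mul_pinfty.
rewrite -ge0_integralZl//; last 2 first.
- by apply: measurable_funTS; exact/measurable_EFinP.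
- by move=> z _; rewrite lee_fin.
rewrite [leRHS]integral_mkcond; apply: ge0_le_integral => //.
- by move=> z _; rewrite lee_fin mulr_ge0 ?pw_ge0// mulr_ge0 ?gauss_ge0.
- by apply: measurable_moment => //; exact: measurable_gweight.
- apply/(measurable_restrictT _ mT); apply: measurable_funeM.
  by apply: measurable_funTS; exact/measurable_EFinP.
- move=> z _; rewrite patchE; case: ifPn => [/set_mem zT|]; last first.
    by rewrite notin_setE => /negP; rewrite -leNgt => Tz; rewrite pw_neg ?subr_le0// mulr0.
  move: zT; rewrite /past/= => zT; have Sz : 0 < S - z.2 by lra.
  rewrite /gweight -EFinM lee_fin -mulrA [leRHS]mulrC ler_wpM2l//.
  have ST0 : 0 < S - T by rewrite subr_gt0.
  apply: (@le_trans _ _ (((4 * pi * (S - z.2)) `^ (n%:R / 2))^-1 * (S - z.2) `^ q)).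
    apply: ler_pM; rewrite ?gauss_ge0 ?pw_ge0//; first exact: gauss_le_peak.
    rewrite pw_pos ?subr_gt0//; apply: ge0_ler_powR; rewrite ?nnegrE//; lra.
  rewrite powRM ?mulr_ge0 ?pi_ge0 ?(ltW Sz)// invfM -mulrA /C ler_wpM2l//.
    by rewrite invr_ge0 powR_ge0.
  rewrite mulrC -powRB ?(gt_eqF Sz) ?implybT//.
  rewrite -[q - _]opprB !(powRN _ (n%:R / 2 - q)) lef_pV2 ?posrE ?powR_gt0//.
  by apply: ge0_ler_powR; rewrite ?nnegrE; lra.
Qed.

Lemma J_injective (alpha : R) (f1 f2 : X -> R) :
  (1 <= n)%N -> 0 < alpha -> alpha < n%:R / 2 + 1 ->
  measurable_fun setT f1 -> measurable_fun setT f2 ->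
  (forall z, 0 <= f1 z) -> (forall z, 0 <= f2 z) ->
  (forall T : R, (\int[nu]_(z in past n T) (f1 z)%:E < +oo)%E) ->
  (forall T : R, (\int[nu]_(z in past n T) (f2 z)%:E < +oo)%E) ->
  {ae nu, forall z, J alpha f1 z = J alpha f2 z} ->
  {ae nu, forall z, f1 z = f2 z}.
Proof.
move=> n1 a0 an mf1 mf2 f10 f20 foo1 foo2 J12.
have [k [b [b01 akb kbn]]] := fractional_exponent alpha n1 an.
have /andP[b0 b1] := b01.
pose p := k%:R + b - alpha.
have p1 : -1 < p by rewrite /p; lra.
have ap : alpha + p = k%:R + b by rewrite /p; ring.
have kb0 : 0 <= k%:R + b by rewrite addr_ge0// ltW.
have c0 : 0 < (Gamma alpha)^-1 * betaR alpha p.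
  by rewrite mulr_gt0 ?invr_gt0 ?Gamma_gt0 ?betaR_gt0.
have m0 (f : X -> R) S y z : (forall z, 0 <= f z) -> 0 <= gweight f S y z.
  by move=> f0; rewrite mulr_ge0 ?gauss_ge0.
have bE (f : X -> R) S y T : measurable_fun setT f ->
    (\int[nu]_w (f w * bheat (alpha + p) T S y w)%:E =
     moment nu snd (gweight f S y) (k%:R + b) T)%E.
  move=> mf; apply: eq_integral => z _; congr EFin.
  by rewrite /gweight /bheat ap; ring.
have eqkb S y T : T < S -> moment nu snd (gweight f1 S y) (k%:R + b) T =
                           moment nu snd (gweight f2 S y) (k%:R + b) T.
  move=> TS; rewrite -!bE//.
  have := J_duality _ a0 _ mf1 f10 _ _ _ y p1 (ltW TS).
  have -> : (\int[nu]_z ((bheat p T S y z)%:E * J alpha f1 z) =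
      \int[nu]_z ((bheat p T S y z)%:E * J alpha f2 z))%E.
    apply: ge0_ae_eq_integral => //.
    - by apply: emeasurable_funM; [apply/measurable_EFinP; exact: measurable_bheat|
        exact: measurable_J].
    - by apply: emeasurable_funM; [apply/measurable_EFinP; exact: measurable_bheat|
        exact: measurable_J].
    - by move=> z _; apply: mule_ge0; [rewrite lee_fin bheat_ge0|exact: J_ge0].
    - by move=> z _; apply: mule_ge0; [rewrite lee_fin bheat_ge0|exact: J_ge0].
    - by apply: filterS J12 => z -> _.
  rewrite (J_duality _ a0 _ mf2 f20 _ _ _ y p1 (ltW TS)).
  move/(congr1 (fun x => ((Gamma alpha)^-1 * betaR alpha p)^-1%:E * x)%E).
  by rewrite !muleA -!EFinM mulVf ?gt_eqF// !mul1e.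
have kbn' : 0 <= k%:R + b <= n%:R / 2 by rewrite kb0.
have n20 : 0 <= (0 : R) <= n%:R / 2 by rewrite lexx divr_ge0.
have eq0 S y T : T < S -> moment nu snd (gweight f1 S y) 0 T =
                          moment nu snd (gweight f2 S y) 0 T.
  apply: (moment_inversion nu snd _ (gweight f1 S y) (gweight f2 S y) S b k).
  - exact: measurable_snd.
  - exact: measurable_gweight.
  - exact: measurable_gweight.
  - by move=> z; exact: m0.
  - by move=> z; exact: m0.
  - exact: b01.
  - by move=> T' TS; exact: eqkb.
  - by move=> T' TS; exact: moment_gweight_lty.
(* The kernel with pole (y, S) has window ends S - eta and S - 2 eta, both before S, so [eq0]
   applies to each. *)
apply: kern_unique => // eta [y S] eta0.
have kE (f : X -> R) : measurable_fun setT f -> (forall z, 0 <= f z) ->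
    (forall T : R, (\int[nu]_(z in past n T) (f z)%:E < +oo)%E) ->
    (\int[nu]_z (f z * kern 1 eta (y, S) z)%:E =
     moment nu snd (gweight f S y) 0 (S - eta) -
     moment nu snd (gweight f S y) 0 (S - eta - eta))%E.
  move=> mf f0 foo; rewrite -moment_incrE//; last 4 first.
  - exact: measurable_gweight.
  - by move=> z; exact: m0.
  - exact: ltW.
  - by apply: moment_gweight_lty => //; lra.
  apply: eq_integral => z _; congr EFin; rewrite /kern /win /gweight/= mul1r.
  rewrite (_ : S - z.2 - eta = S - eta - z.2); last by ring.
  rewrite (_ : S - z.2 - 2 * eta = S - eta - eta - z.2); last by ring.
  by ring.
by rewrite !kE// !eq0//; lra.
Qed.

End injectivity.

(** * The two halves of the equivalence *)

Section main.
Context {R : realType} {n : nat}.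
Local Notation mu := (@lebesgue_measure R).
Local Notation X := (n.-tuple R * R)%type.
Local Notation nu := (@lebesgue_spacetime R n).
Implicit Types (f u : X -> R).

Definition origin : n.-tuple R := [tuple 0 | i < n].

Lemma X1_pos f : X1 n f -> measurable_fun setT (f^\+)%R /\
  forall T : R, (\int[nu]_(z in past n T) ((f^\+)%R z)%:E < +oo)%E.
Proof.
move=> [mf foo]; split; first exact: measurable_funrpos.
move=> T; apply: le_lt_trans (foo T).
have mT := measurable_past (n := n) T; apply: ge0_le_integral => //.
- by move=> z _; rewrite lee_fin funrpos_ge0.
- apply: measurable_funTS; apply/measurable_EFinP; exact: measurable_funrpos.
- by apply: measurable_funTS; apply/measurable_EFinP; exact: measurableT_comp.
- by move=> z _; rewrite lee_fin /funrpos ge_max ler_norm normr_ge0.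
Qed.

Lemma X1_neg f : X1 n f -> measurable_fun setT (f^\-)%R /\
  forall T : R, (\int[nu]_(z in past n T) ((f^\-)%R z)%:E < +oo)%E.
Proof.
move=> [mf foo]; split; first exact: measurable_funrneg.
move=> T; apply: le_lt_trans (foo T).
have mT := measurable_past (n := n) T; apply: ge0_le_integral => //.
- by move=> z _; rewrite lee_fin funrneg_ge0.
- apply: measurable_funTS; apply/measurable_EFinP; exact: measurable_funrneg.
- by apply: measurable_funTS; apply/measurable_EFinP; exact: measurableT_comp.
- by move=> z _; rewrite lee_fin /funrneg ge_max normr_ge0 andbT -normrN ler_norm.
Qed.

Lemma frac_heatP (alpha : R) u : Y1 n alpha u ->
  X1 n (frac_heat alpha u) /\ is_J alpha (frac_heat alpha u) u.
Proof. by move=> [f Xf Jf]; rewrite /frac_heat; case: xgetP => [g _ []|/(_ f)[]//]. Qed.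

(** Reduction to [no_mass]: f >= u^lambda >= 0 almost everywhere, and f vanishes at negative times
    because u does, so f may be replaced by a representative with both properties at every point. *)
Lemma supersolution_trivial (alpha lambda : R) f u :
  0 < alpha -> 1 < lambda -> 1 <= alpha * lambda / (lambda - 1) - n%:R / 2 ->
  X1 n f -> is_J alpha f u ->
  {ae nu, forall z, u z `^ lambda <= f z} ->
  {ae nu, forall z, z.2 < 0 -> u z = 0} ->
  {ae nu, forall z, u z = 0}.
Proof.
move=> a0 l1 E1 Xf Jf uf u0.
have mf := Xf.1; have [mp poo] := X1_pos f Xf.
have p0 (z : X) : 0 <= (f^\+)%R z by exact: funrpos_ge0.
have fp : {ae nu, forall z, f z = (f^\+)%R z}.
  apply: filterS uf => z uz; rewrite /funrpos max_l//.
  exact: le_trans (powR_ge0 _ _) uz.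
have uJ : {ae nu, forall z, (u z)%:E = J alpha (f^\+)%R z}.
  by apply: filterS Jf => z ->; apply: J_ae_eq.
have pp : -1 < alpha by lra.
have past0 : {ae nu, forall z : X, z.2 < 0 -> (f^\+)%R z = 0}.
  have c0 : 0 < (Gamma alpha)^-1 * betaR alpha alpha.
    by rewrite mulr_gt0 ?invr_gt0 ?Gamma_gt0 ?betaR_gt0.
  (* With T = 0 the test function lives at negative times, where u = 0; its adjoint image is
     positive at every negative time, which forces f to vanish there. *)
  have := J_duality _ a0 _ mp p0 alpha 0 1 origin pp ler01.
  have -> : (\int[nu]_z ((bheat alpha 0 1 origin z)%:E * J alpha (f^\+)%R z) = 0)%E.
    rewrite -(integral0 nu setT); apply: ge0_ae_eq_integral => //.
    - by apply: emeasurable_funM; [apply/measurable_EFinP; exact: measurable_bheat|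
        exact: measurable_J].
    - by move=> z _; apply: mule_ge0; [rewrite lee_fin bheat_ge0|exact: J_ge0].
    - apply: filterS2 uJ u0 => z uz uz0 _; have [zn|zp] := ltP z.2 0.
        by rewrite -uz uz0// mule0.
      by rewrite /bheat pw_neg ?sub0r ?oppr_le0// mul0r mul0e.
  move/esym/eqP; rewrite mule_eq0 eqe gt_eqF//= => /eqP I0.
  have mfb : measurable_fun setT
      (fun w => ((f^\+)%R w * bheat (alpha + alpha) 0 1 origin w)%:E).
    apply/measurable_EFinP; apply: measurable_funM => //; exact: measurable_bheat.
  have fb0 (w : X) : (0 <= ((f^\+)%R w * bheat (alpha + alpha) 0 1 origin w)%:E)%E.
    by rewrite lee_fin mulr_ge0 ?bheat_ge0.
  apply: filterS (integral_eq0_ae _ _ _ nu _ mfb fb0 I0) => z /eqP.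
  rewrite eqe mulf_eq0 => /orP[/eqP//|/eqP b0 zn].
  suff : 0 < bheat (alpha + alpha) 0 1 origin z by rewrite b0 ltxx.
  by rewrite mulr_gt0 ?pw_gt0 ?gauss_gt0//; lra.
pose g (z : X) : R := (f^\+)%R z * \1_(~` past n (0 : R)) z.
have mpast0 := measurable_past (n := n) (0 : R).
have mg : measurable_fun setT g.
  by apply: measurable_funM => //; apply: measurable_indic; exact: measurableC.
have g0 z : 0 <= g z by rewrite mulr_ge0// indicE ler0n.
have fg : {ae nu, forall z, (f^\+)%R z = g z}.
  apply: filterS past0 => z z0; rewrite /g indicE; have [zn|zp] := ltP z.2 0.
    by rewrite z0// mul0r.
  by rewrite mem_set ?mulr1// => /lt_le_trans/(_ zp); rewrite ltxx.
have gf z : g z <= (f^\+)%R z.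
  by rewrite /g indicE; case: (_ \in _); rewrite ?mulr1 ?mulr0.
have Ig : (\int[nu]_z (g z)%:E = 0)%E.
  apply: (@no_mass R n alpha lambda g u origin) => //.
  - move=> z zn; rewrite /g indicE memNset ?mulr0//.
  - move=> T; apply: le_lt_trans (poo T); have mT := measurable_past (n := n) T.
    apply: ge0_le_integral => //.
    + by move=> z _; rewrite lee_fin.
    + by apply: measurable_funTS; exact/measurable_EFinP.
    + by apply: measurable_funTS; exact/measurable_EFinP.
    + by move=> z _; rewrite lee_fin.
  - by apply: filterS uJ => z ->; apply: J_ae_eq.
  - by apply: filterS3 uf fp fg => z h <- <-.
have mgE : measurable_fun setT (fun z => (g z)%:E) by exact/measurable_EFinP.
have gE0 (z : X) : (0 <= (g z)%:E)%E by rewrite lee_fin.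
have g_ae := integral_eq0_ae _ _ _ nu _ mgE gE0 Ig.
apply: filterS uJ => z uz; apply/eqP; rewrite -eqe uz; apply/eqP.
rewrite (@J_ae_eq R n alpha _ (cst 0) z)//.
  by rewrite J_fheat integral0_eq// => w _; rewrite !mulr0.
by apply: filterS2 fg g_ae => w -> /eqP; rewrite eqe => /eqP.
Qed.

(** The sign of [f] is unknown, so J f = J g is rearranged into equality of J on the nonnegative
    functions f^+ and g + f^-. *)
Lemma J_unique (alpha : R) f g u : (1 <= n)%N -> 0 < alpha -> alpha < n%:R / 2 + 1 ->
  X1 n f -> X1 n g -> (forall z, 0 <= g z) ->
  is_J alpha f u -> is_J alpha g u -> {ae nu, forall z, f z = g z}.
Proof.
move=> n1 a0 an Xf Xg g0 Jf Jg.
have [mp poo] := X1_pos f Xf; have [mn noo] := X1_neg f Xf.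
have mf := Xf.1; have mg := Xg.1.
have n0 (z : X) : 0 <= (f^\-)%R z by exact: funrneg_ge0.
have p0 (z : X) : 0 <= (f^\+)%R z by exact: funrpos_ge0.
have goo T : (\int[nu]_(z in past n T) (g z)%:E < +oo)%E.
  have := Xg.2 T; under eq_integral do rewrite ger0_norm//.
  exact.
have mgn : measurable_fun setT (g \+ (f^\-)%R) by exact: measurable_funD.
have gn0 z : 0 <= (g \+ (f^\-)%R) z by rewrite /= addr_ge0.
have : {ae nu, forall z, (f^\+)%R z = (g \+ (f^\-)%R) z}.
  apply: (@J_injective R n alpha) => //.
  - move=> T; have mT := measurable_past (n := n) T.
    rewrite [ltLHS](_ : _ = \int[nu]_(z in past n T) (g z)%:E +
      \int[nu]_(z in past n T) ((f^\-)%R z)%:E)%E; first exact: lte_add_pinfty.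
    rewrite -ge0_integralD//.
    + by move=> z _; rewrite lee_fin.
    + by apply: measurable_funTS; exact/measurable_EFinP.
    + by move=> z _; rewrite lee_fin.
    + by apply: measurable_funTS; exact/measurable_EFinP.
  - apply: filterS2 Jf Jg => z Jfz Jgz; rewrite J_add// -Jgz.
    move: Jfz; rewrite J_posneg//.
    have := @J_ge0 R n alpha a0 _ p0 z; have := @J_ge0 R n alpha a0 _ n0 z.
    (* The difference is the real number u z, so neither term can be infinite and the subtraction
       can be undone. *)
    by case: (J alpha (f^\-)%R z) => [r2| |]//; case: (J alpha (f^\+)%R z) => [r1| |]//= _ _ [->];
      rewrite -EFinD subrK.
apply: filterS => z /= h; rewrite -[f]funrposBneg/= !fctE h; ring.
Qed.

Section existence.
Variables (alpha lambda : R).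
Hypotheses (alpha_gt0 : 0 < alpha) (lambda_gt1 : 1 < lambda).
Let b := alpha * lambda / (lambda - 1) - n%:R / 2.
Hypothesis b1 : b < 1.
Let w0 : X := (origin, 0).
Let l10 : 0 < lambda - 1. Proof. by rewrite subr_gt0. Qed.
Let K := (Gamma alpha)^-1 * betaR (1 - b) (alpha - 1).
Let b1' : 0 < 1 - b. Proof. by rewrite subr_gt0. Qed.
Let aN1 : -1 < alpha - 1. Proof. by rewrite ltrBrDr addrC subrr. Qed.
Let K0 : 0 < K.
Proof. by rewrite mulr_gt0 ?invr_gt0 ?Gamma_gt0 ?betaR_gt0. Qed.
Let P : R := ((4 * pi) `^ (n%:R / 2))^-1.
Let P0 : 0 < P. Proof. by rewrite invr_gt0 powR_gt0// mulr_gt0 ?pi_gt0. Qed.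
Let A := K `^ lambda * P `^ (lambda - 1).
Let A0 : 0 < A. Proof. by rewrite mulr_gt0 ?powR_gt0. Qed.
(** Solves eps^(lambda - 1) * A = 1, where [A] gathers K^lambda from [J] and P^(lambda - 1) from the
    peak of the Gaussian; the constants in the supersolution inequality then balance. *)
Let eps := A `^ (- (lambda - 1)^-1).
Let eps0 : 0 < eps. Proof. exact: powR_gt0. Qed.
Let epsE : eps `^ lambda = eps * A^-1.
Proof.
have lE : lambda = 1 + (lambda - 1) by ring.
rewrite [in LHS]lE powRD ?(gt_eqF eps0) ?implybT// powRr1 ?(ltW eps0)//.
congr (_ * _); rewrite /eps -powRrM mulNr mulVf ?gt_eqF// powRN powRr1//.
exact: ltW.
Qed.

Definition selfsim_source (z : X) : R := eps * fheat (- b) w0 z.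
Definition selfsim_solution (z : X) : R := eps * K * fheat (alpha - b) w0 z.

Lemma measurable_fheat0 q : measurable_fun setT (fheat q w0).
Proof. exact: measurable_fheat. Qed.

(** The kernel of [J] seen from [z] is a [bheat] with T = S = z.2, so [integral_fheat_bheat] applies
    with a = 1 - b and p = alpha - 1. *)
Lemma J_selfsim z : J alpha selfsim_source z = (selfsim_solution z)%:E.
Proof.
rewrite J_fheat; transitivity (\int[nu]_w ((eps * (Gamma alpha)^-1)%:E *
    (fheat ((1 - b) - 1) w0 w * bheat (alpha - 1) z.2 z.2 z.1 w)%:E))%E.
  apply: eq_integral => w _; rewrite -EFinM; congr EFin.
  rewrite /selfsim_source (_ : 1 - b - 1 = - b); last by ring.
  by rewrite -/(fheat (alpha - 1) w z); ring.
rewrite ge0_integralZl//; last 3 first.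
- apply/measurable_EFinP; apply: measurable_funM; first exact: measurable_fheat.
  exact: measurable_bheat.
- by move=> w _; rewrite lee_fin mulr_ge0 ?fheat_ge0 ?bheat_ge0.
- by rewrite lee_fin mulr_ge0 ?invr_ge0 ?ltW// Gamma_gt0.
rewrite integral_fheat_bheat// -EFinM; congr EFin.
rewrite /selfsim_solution /K /fheat (_ : 1 - b + (alpha - 1) = alpha - b); last by ring.
by ring.
Qed.

Lemma selfsim_source_ge0 z : 0 <= selfsim_source z.
Proof. by rewrite mulr_ge0 ?fheat_ge0// ltW. Qed.

(** The Gaussian integrates to one in space; with [pw 0] as cut-off at T, a beta integral with first
    argument 1 - b > 0 remains. *)
Lemma X1_selfsim : X1 n selfsim_source.
Proof.
have ms : measurable_fun setT selfsim_source.
  by apply: measurable_funM => //; exact: measurable_fheat0.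
split => // T.
rewrite [ltLHS](_ : _ = \int[nu]_z (eps%:E *
    (pw (1 - b - 1) (z.2 - 0) * pw 0 (T - z.2) *
     gauss (z.2 - 0) (tuple_sub z.1 origin))%:E))%E; last first.
  rewrite integral_mkcond; apply: eq_integral => z _; rewrite patchE -EFinM.
  have [zT|Tz] := ltP z.2 T; last first.
    rewrite memNset; last by rewrite /past/= => /lt_le_trans/(_ Tz); rewrite ltxx.
    by rewrite [pw 0 _]pw_neg ?subr_le0// mulr0 mul0r mulr0.
  rewrite mem_set// ger0_norm ?selfsim_source_ge0//; congr EFin.
  rewrite /selfsim_source fheatE gaussC/= [pw 0 _]pw_pos ?subr_gt0// powRr0 mulr1.
  by rewrite (_ : 1 - b - 1 = - b)//; ring.
have mG : measurable_fun setT (fun z : X => (pw (1 - b - 1) (z.2 - 0) * pw 0 (T - z.2) *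
     gauss (z.2 - 0) (tuple_sub z.1 origin))%:E).
  apply/measurable_EFinP; apply: measurable_funM.
    by apply: measurable_funM; apply: measurable_pw; exact: measurable_funB.
  by apply: measurable_gauss; [exact: measurable_funB|exact: measurable_tuple_sub].
have G0 (z : X) : (0 <= (pw (1 - b - 1) (z.2 - 0) * pw 0 (T - z.2) *
     gauss (z.2 - 0) (tuple_sub z.1 origin))%:E)%E.
  by rewrite lee_fin mulr_ge0 ?gauss_ge0// mulr_ge0 ?pw_ge0.
rewrite ge0_integralZl//; last by rewrite lee_fin ltW.
apply: lte_mul_pinfty => //; first by rewrite lee_fin ltW.
rewrite ge0_integral_spacetime//.
rewrite (_ : (fun t => _) = fun t => (pw (1 - b - 1) (t - 0) * pw 0 (T - t))%:E).
  by rewrite integral_beta// ?ltry// ltrN10.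
apply/funext => t /=; under eq_integral do rewrite EFinM.
rewrite ge0_integralZl//; last 3 first.
- apply/measurable_EFinP; apply: measurable_gauss => //; exact: measurable_tuple_sub.
- by move=> x _; rewrite lee_fin gauss_ge0.
- by rewrite lee_fin mulr_ge0 ?pw_ge0.
have [t0|t0] := leP t 0; first by rewrite pw_neg ?subr0// mul0r mul0e.
by rewrite integral_gauss ?subr0// mule1.
Qed.

Lemma selfsim_supersolution z : selfsim_solution z `^ lambda <= selfsim_source z.
Proof.
have l0 : lambda != 0 by rewrite gt_eqF// (lt_trans _ lambda_gt1).
rewrite /selfsim_solution /selfsim_source !fheatE/= !subr0.
have [t0|t0] := leP z.2 0; first by rewrite !pw_neg// mul0r !mulr0 powR0.
rewrite !pw_pos//; set G := gauss _ _; have G0 : 0 < G by exact: gauss_gt0.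
have GP : G <= P * z.2 `^ (- (n%:R / 2)).
  apply: (le_trans (gauss_le_peak _ _ _ t0)).
  by rewrite powRM ?mulr_ge0 ?pi_ge0 ?(ltW t0)// invfM powRN.
have eK0 : 0 <= eps * K by exact: ltW (mulr_gt0 eps0 K0).
have tG0 : 0 <= z.2 `^ (alpha - b) * G by exact: mulr_ge0 (powR_ge0 _ _) (ltW G0).
rewrite (powRM lambda eK0 tG0) (powRM lambda (ltW eps0) (ltW K0)).
rewrite (powRM lambda (powR_ge0 _ _) (ltW G0)) epsE -powRrM.
have lE : lambda = (lambda - 1) + 1 by ring.
have -> : G `^ lambda = G `^ (lambda - 1) * G.
  by rewrite {1}lE powRD ?(gt_eqF G0) ?implybT// (powRr1 (ltW G0)).
have GPl : G `^ (lambda - 1) <= P `^ (lambda - 1) * z.2 `^ (- (n%:R / 2) * (lambda - 1)).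
  rewrite powRrM -powRM ?powR_ge0 ?(ltW P0)//.
  by apply: ge0_ler_powR; rewrite ?nnegrE ?(ltW l10) ?(ltW G0)// mulr_ge0 ?powR_ge0 ?(ltW P0).
(* This balance of time exponents is the equation that determines [b]. *)
have tE : z.2 `^ ((alpha - b) * lambda) * z.2 `^ (- (n%:R / 2) * (lambda - 1)) = z.2 `^ (- b).
  rewrite -powRD ?(gt_eqF t0) ?implybT//; congr powR.
  by rewrite /b; field; rewrite gt_eqF.
apply: (@le_trans _ _ (eps * A^-1 * K `^ lambda * (z.2 `^ ((alpha - b) * lambda) *
   (P `^ (lambda - 1) * z.2 `^ (- (n%:R / 2) * (lambda - 1)) * G)))).
  rewrite ler_wpM2l ?mulr_ge0 ?invr_ge0 ?powR_ge0 ?(ltW A0) ?(ltW eps0)//.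
  by rewrite ler_wpM2l ?powR_ge0// ler_wpM2r ?(ltW G0).
rewrite -tE le_eqVlt; apply/orP; left; apply/eqP; rewrite /A.
by field; rewrite !gt_eqF ?powR_gt0.
Qed.

(** Pairing the solution with a backward kernel gives an explicit positive number; a = alpha - b + 1
    is chosen so that a - 1 is the solution's exponent. *)
Lemma selfsim_nontrivial : ~ {ae nu, forall z, selfsim_solution z = 0}.
Proof.
move=> u0.
have ab : 0 < alpha - b + 1 by move: b1' alpha_gt0; lra.
have := integral_fheat_bheat (alpha - b + 1) 0 2 2 origin w0 ab (ltrN10 R) (lexx 2).
rewrite (_ : (\int[nu]_z _)%E = 0%E); last first.
  rewrite -(integral0 nu setT); apply: ge0_ae_eq_integral => //.
  - apply/measurable_EFinP; apply: measurable_funM; first exact: measurable_fheat.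
    exact: measurable_bheat.
  - by move=> z _; rewrite lee_fin mulr_ge0 ?fheat_ge0 ?bheat_ge0.
  - have eK : eps * K != 0 by exact: lt0r_neq0 (mulr_gt0 eps0 K0).
    apply: filterS u0 => z /eqP; rewrite /selfsim_solution mulf_eq0 (negbTE eK)/=.
    by move=> /eqP h _; rewrite addrK h mul0r.
move/esym/eqP; rewrite eqe; apply/negP; rewrite gt_eqF// mulr_gt0 ?betaR_gt0//.
by rewrite mulr_gt0 ?pw_gt0 ?gauss_gt0//= subr0.
Qed.

End existence.
End main.

Theorem corollary2p2 (R : realType) (n : nat) (alpha lambda : R)
    (n_ge1 : (1 <= n)%N)
    (alpha_gt0 : 0 < alpha) (alpha_le : alpha <= (n%:R + 2) / 2)
    (lambda_gt1 : 1 < lambda) :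
  (exists u : n.-tuple R * R -> R,
    [/\ Y1 n alpha u,
        {ae lebesgue_spacetime n, forall z, 0 <= u z},
        ~ {ae lebesgue_spacetime n, forall z, u z = 0},
        {ae lebesgue_spacetime n, forall z,
           u z `^ lambda <= frac_heat alpha u z} &
        {ae lebesgue_spacetime n, forall z, z.2 < 0 -> u z = 0}])
  <->
  (alpha <> (n%:R + 2) / 2 /\
   1 + 2 * alpha / (n%:R + 2 - 2 * alpha) < lambda).
Proof.
have l10 : 0 < lambda - 1 by rewrite subr_gt0.
split.
- move=> [u [Yu u_ge0 u_neq0 uf u_past]]; apply: contrapT => /not_andP H.
  apply: u_neq0; have [Xf Jf] := frac_heatP alpha u Yu.
  apply: (supersolution_trivial alpha lambda (frac_heat alpha u) u) => //.
  rewrite lerBrDr ler_pdivlMr//.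
  (* At alpha = (n + 2)/2 the quotient in the threshold is a division by 0, with value 0, so the
     threshold is 1. That case is settled separately: b >= 1 then holds for every lambda > 1. *)
  case: H => [/contrapT aE|/negP]; first by rewrite aE; lra.
  rewrite -leNgt => lle; have [aE|an] := eqVneq alpha ((n%:R + 2) / 2).
    by rewrite aE; lra.
  have alt : alpha < (n%:R + 2) / 2 by rewrite lt_neqAle an.
  have d0 : 0 < n%:R + 2 - 2 * alpha by lra.
  have : lambda - 1 <= 2 * alpha / (n%:R + 2 - 2 * alpha) by lra.
  by rewrite ler_pdivlMr//; lra.
- move=> [/eqP an lgt].
  have alt : alpha < (n%:R + 2) / 2 by rewrite lt_neqAle an.
  have d0 : 0 < n%:R + 2 - 2 * alpha by lra.
  have b1 : alpha * lambda / (lambda - 1) - n%:R / 2 < 1.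
    rewrite ltrBlDr ltr_pdivrMr//.
    have : 2 * alpha / (n%:R + 2 - 2 * alpha) < lambda - 1 by lra.
    by rewrite ltr_pdivrMr//; lra.
  pose f := @selfsim_source R n alpha lambda; pose u := @selfsim_solution R n alpha lambda.
  have Xf : X1 n f by exact: X1_selfsim.
  have Jf : is_J alpha f u by apply: aeW => z; rewrite J_selfsim.
  have Yu : Y1 n alpha u by exists f.
  have [Xg Jg] := frac_heatP alpha u Yu.
  have u_ge0 z : 0 <= u z by rewrite -lee_fin -J_selfsim// J_ge0// => w; exact: selfsim_source_ge0.
  exists u; split => //.
  + exact: aeW.
  + exact: selfsim_nontrivial.
  + have f_ge0 z : 0 <= f z by exact: selfsim_source_ge0.
    have alt' : alpha < n%:R / 2 + 1 by lra.
    (* [frac_heat] returns some preimage of u; uniqueness identifies it almost everywhere with the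
       explicit source. *)
    have := @J_unique R n alpha (frac_heat alpha u) f u n_ge1 alpha_gt0 alt' Xg Xf
      f_ge0 Jg Jf.
    by apply: filterS => z ->; exact: selfsim_supersolution.
  + apply: aeW => z z0; rewrite /u /selfsim_solution fheatE pw_neg ?mul0r ?mulr0//.
    by rewrite subr0 ltW.
Qed.
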